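(* Let $\lambda$ be a partition and write $\tau^l(\lambda)=(\boldsymbol{\lambda}^l,\mathbf{s}^l)$ and $\tau_e(\lambda)=(\boldsymbol{\lambda}_e,\mathbf{s}_e)$. Then for every $i\in\{1,\dots,e-1\}$, $$(\tau^l)^{-1}\big(\sigma_i\star\boldsymbol{\lambda}^l,\ \mathbf{s}^l\big)=\tau_e^{-1}\big(\Psi^{\mathbf{s}_e\to\mathbf{s}_e.\sigma_i}(\boldsymbol{\lambda}_e),\ \sigma_i.\mathbf{s}_e\big).$$
   Context: Fix integers $e\ge 2$, $l\ge 1$ and $m\in\mathbb{Z}$. For $r\ge1$, $\Pi^r$ is the set of $r$-partitions ($r$-tuples of partitions) and $\mathbb{Z}^r[m]=\{(s_0,\dots,s_{r-1})\in\mathbb{Z}^r:\sum_{i=0}^{r-1}s_i=m\}$. Symbols. A symbol of charge $m$ is a strictly increasing sequence of integers $(\beta_i)_{i<m}$ with $\beta_j=j$ for all sufficiently negative $j$, identified with the set of its entries. For a partition $\lambda=(\lambda_1\ge\lambda_2\ge\cdots)$ (with $\lambda_k=0$ for large $k$) put $X^m(\lambda)=\{\lambda_j-j+m: j\ge1\}$; this gives a bijection between partitions and symbols of charge $m$. A pair $(\boldsymbol{\lambda},\mathbf{s})\in\Pi^r\times\mathbb{Z}^r$ has $r$-symbol $(X^{s_0}(\lambda^0),\dots,X^{s_{r-1}}(\lambda^{r-1}))$; this is a bijection onto $r$-tuples of symbols, $\mathbf{s}$ being the tuple of charges. $\tau_e$: for a partition $\lambda$, put $Y^j=\{k\in\mathbb{Z}: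 j+ke\in X^m(\lambda)\}$ for $0\le j\le e-1$; $\tau_e(\lambda)\in\Pi^e\times\mathbb{Z}^e[m]$ is the pair whose $e$-symbol is $(Y^0,\dots,Y^{e-1})$. $\tau^l$: write each $\beta\in X^m(\lambda)$ uniquely as $\beta=c+ed+elq$ with $0\le c\le e-1$, $0\le d\le l-1$, $q\in\mathbb{Z}$, and let $X_d$ be the set of all $c+eq$ coming from the $\beta$ with this value of $d$; $\tau^l(\lambda)\in\Pi^l\times\mathbb{Z}^l[m]$ is the pair whose $l$-symbol is $(X_{l-1},X_{l-2},\dots,X_0)$. For fixed $m$, $\tau_e$ and $\tau^l$ are bijections from the set of partitions onto $\Pi^e\times\mathbb{Z}^e[m]$ and $\Pi^l\times\mathbb{Z}^l[m]$. Action on multicharges. For $1\le i\le e-1$ and $\mathbf{s}_e=(s_0,\dots,s_{e-1})$, both $\sigma_i.\mathbf{s}_e$ and $\mathbf{s}_e.\sigma_i$ denote the multicharge obtained from $\mathbf{s}_e$ by exchanging $s_{i-1}$ and $s_i$. The operation $\star$. Let $\boldsymbol{\lambda}^l=(\lambda^0,\dots,\lambda^{l-1})\in\Pi^l$ and $\mathbf{s}^l=(t_0,\dots,t_{l-1})$. The Young diagram is $[\boldsymbol{\lambda}^l]=\{(a,b,c):a\ge1,\ 0\le c\le l-1,\ 1\le b\le\lambda^c_a\}$; a node $(a,b,c)$ has content $b-a+t_c$ and residue its content modulo $e$. A node is a removable (resp. addable) $i$-node if it has residue $i\bmod e$ and deleting it from (resp. adding it to) $[\boldsymbol{\lambda}^l]$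 yields the Young diagram of an $l$-partition. Order nodes by: $(a,b,c)<(a',b',c')$ if $b-a+t_c<b'-a'+t_{c'}$, or if $b-a+t_c=b'-a'+t_{c'}$ and $c>c'$. Write the addable and removable $i$-nodes of $\boldsymbol{\lambda}^l$ in increasing order, encoding each addable one by $A$ and each removable one by $R$, and repeatedly delete subwords $RA$ until a word $A^pR^q$ remains (the reduced $i$-signature). If $p>0$, $\widetilde f_i\boldsymbol{\lambda}^l$ is obtained by adding the node of the rightmost remaining $A$ (and $\widetilde f_i\boldsymbol{\lambda}^l=0$ if $p=0$); if $q>0$, $\widetilde e_i\boldsymbol{\lambda}^l$ is obtained by removing the node of the leftmost remaining $R$ (and $\widetilde e_i\boldsymbol{\lambda}^l=0$ if $q=0$). Put $\varepsilon_i(\boldsymbol{\lambda}^l)=\max\{k\ge0:\widetilde f_i^{\,k}\boldsymbol{\lambda}^l\ne0\}=p$ and $\varphi_i(\boldsymbol{\lambda}^l)=\max\{k\ge0:\widetilde e_i^{\,k}\boldsymbol{\lambda}^l\ne0\}=q$. Then $$\sigma_i\star\boldsymbol{\lambda}^l=\begin{cases}\widetilde e_i^{\,\varphi_i-\varepsilon_i}\boldsymbol{\lambda}^l&\text{if }\varphi_i(\boldsymbol{\lambda}^l)\ge\varepsilon_i(\boldsymbol{\lambda}^l),\\ \widetilde f_i^{\,\varepsilon_i-\varphi_i}\boldsymbol{\lambda}^l&\text{if }\varphi_i(\boldsymbol{\lambda}^l)\le\varepsilon_i(\boldsymbol{\lambda}^l).\end{cases}$$ The bijection $\Psi^{\mathbf{s}_e\to\mathbf{s}_e.\sigma_i}:\Pi^e\to\Pi^e$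 (crystal isomorphism), $1\le i\le e-1$. Let $(Y^0,\dots,Y^{e-1})$ be the $e$-symbol of $(\boldsymbol{\lambda}_e,\mathbf{s}_e)$. Choose $N$ such that $Y^{i-1}$ and $Y^i$ both contain all integers $<N$; write the elements $\ge N$ of $Y^{i-1}$ as $U=\{x_1<\dots<x_r\}$ and those of $Y^i$ as $V=\{y_1<\dots<y_s\}$ (so $r\ge s$ iff $s_{i-1}\ge s_i$). - If $r\ge s$: treat $y_1,y_2,\dots,y_s$ successively. To the current $y$ associate, among the elements of $U$ not yet chosen, the smallest $x$ with $x\ge y$ if such an $x$ exists, and otherwise the smallest element of $U$ not yet chosen. Let $C\subset U$ be the set of the $s$ chosen elements. Replace $U$ by $U'=C$ and $V$ by $V'$, the increasing reordering of $(U\setminus C)\sqcup V$. - If $r<s$: treat $x_1,x_2,\dots,x_r$ successively. To the current $x$ associate, among the elements of $V$ not yet chosen, the largest $y$ with $y\le x$ if such a $y$ exists, and otherwise the largest element of $V$ not yet chosen. Let $C\subset V$ be the set of the $r$ chosen elements. Replace $V$ by $V'=C$ and $U$ by $U'$, the increasing reordering of $(V\setminus C)\sqcup U$. In both cases the new sets, completed by all integers $<N$, replace $Y^{i-1}$ (by $U'$) and $Y^i$ (by $V'$), the other components being unchanged. The resulting $e$-symbol has multicharge $\mathbf{s}_e.\sigma_i$, and $\Psi^{\mathbf{s}_e\to\mathbf{s}_e.\sigma_i}(\boldsymbol{\lambda}_e)$ is the $e$-partition it defines. *)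

(* Defs.v *)
From HB Require Import structures.
From mathcomp Require Import all_boot all_order all_algebra.
From mathcomp Require Import perm.
From mathcomp Require Import boolp classical_sets functions.
From mathcomp Require Import zify.
Set Implicit Arguments.
Unset Strict Implicit.
Unset Printing Implicit Defensive.
Import Order.TTheory GRing.Theory Num.Theory.
Local Open Scope classical_set_scope.
Local Open Scope ring_scope.

Definition is_intpart (p : seq nat) : bool := sorted geq p && (0%N \notin p).

Record intpart := IntPart { parts :> seq nat; _ : is_intpart parts }.

HB.instance Definition _ := [isSub for parts].
HB.instance Definition _ := [Choice of intpart by <:].

Definition empty_part : intpart := @IntPart [::] isT.

(* The k-th part, numbered from k = 1; only used for k >= 1. *)
Definition part (lam : intpart) (k : nat) : nat := nth 0%N lam k.-1.

Definition rpart (r : nat) := {ffun 'I_r -> intpart}.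
Definition charge (r : nat) := {ffun 'I_r -> int}.

Definition charges (r : nat) (m : int) : set (charge r) :=
  [set s | \sum_i s i = m].

Definition beta (m : int) (lam : intpart) (j : nat) : int :=
  (part lam j)%:Z - j%:Z + m.

Definition symbol (m : int) (lam : intpart) : set int :=
  [set x | exists2 j, (1 <= j)%N & x = beta m lam j].

(* The inverse of (lam, m) |-> symbol m lam; see [symbolK] and
   [of_symbolK] below. *)
Definition of_symbol (S : set int) : intpart * int :=
  xget (empty_part, 0) [set x | symbol x.2 x.1 = S].

Definition of_symbols (r : nat) (S : 'I_r -> set int) : rpart r * charge r :=
  ([ffun j => (of_symbol (S j)).1], [ffun j => (of_symbol (S j)).2]).

Definition residue_symbol (e : nat) (m : int) (lam : intpart) (j : 'I_e) :
    set int :=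
  [set k | symbol m lam (j%:Z + k * e%:Z)].

Definition tau_e (e : nat) (m : int) (lam : intpart) : rpart e * charge e :=
  of_symbols (residue_symbol m lam).

Definition level_symbol (e l : nat) (m : int) (lam : intpart) (d : 'I_l) :
    set int :=
  [set x | exists (c : nat) (q : int),
     [/\ (c < e)%N,
         symbol m lam (c%:Z + e%:Z * d%:Z + e%:Z * l%:Z * q)
       & x = c%:Z + e%:Z * q]].

(* [rev_ord j] has value l - 1 - j. *)
Definition tau_l (e l : nat) (m : int) (lam : intpart) : rpart l * charge l :=
  of_symbols (fun j => level_symbol e m lam (rev_ord j)).

(* [tau_e_bij] and [tau_l_bij] below show that tau_e and tau_l are bijections
   onto the pairs whose charge belongs to [charges _ m], so the default value
   of 'pinv_ is not used there. *)
Definition tau_e_inv (e : nat) (m : int) : rpart e * charge e -> intpart :=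
  'pinv_(fun=> empty_part) [set: intpart] (tau_e e m).

Definition tau_l_inv (e l : nat) (m : int) : rpart l * charge l -> intpart :=
  'pinv_(fun=> empty_part) [set: intpart] (tau_l e l m).

(* For i > 0 this is i - 1. *)
Definition prev_ord (e : nat) (i : 'I_e) : 'I_e :=
  Ordinal (leq_ltn_trans (leq_pred i) (ltn_ord i)).

Definition sigma_act (e : nat) (i : 'I_e) (s : charge e) : charge e :=
  [ffun j => s (tperm (prev_ord i) i j)].

Definition node (l : nat) := (nat * nat * 'I_l)%type.

Definition diagram (l : nat) (lam : rpart l) : set (node l) :=
  [set g | let: (a, b, c) := g in
           [/\ (1 <= a)%N, (1 <= b)%N & (b <= part (lam c) a)%N]].

Definition content (l : nat) (s : charge l) (g : node l) : int :=
  let: (a, b, c) := g in b%:Z - a%:Z + s c.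

Definition node_lt (l : nat) (s : charge l) : rel (node l) :=
  fun g h => (content s g < content s h) ||
             ((content s g == content s h) && (h.2 < g.2)%N).

Definition addable (l : nat) (lam : rpart l) (g : node l) : Prop :=
  ~ diagram lam g /\ exists mu : rpart l, diagram mu = g |` diagram lam.

Definition removable (l : nat) (lam : rpart l) (g : node l) : Prop :=
  diagram lam g /\ exists mu : rpart l, diagram mu = diagram lam `\ g.

Definition add_node (l : nat) (lam : rpart l) (g : node l) : rpart l :=
  xget lam [set mu | diagram mu = g |` diagram lam].

Definition remove_node (l : nat) (lam : rpart l) (g : node l) : rpart l :=
  xget lam [set mu | diagram mu = diagram lam `\ g].

Definition has_residue (e i l : nat) (s : charge l) (g : node l) : bool :=
  (content s g == i%:Z %[mod e%:Z])%Z.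

(* The addable and removable i-nodes, in increasing order; this list exists
   and is unique, see [signatureP]. *)
Definition signature (e i l : nat) (s : charge l) (lam : rpart l) :
    seq (node l) :=
  xget [::] [set w | sorted (node_lt s) w /\
    forall g, g \in w <->
              has_residue e i s g /\ (addable lam g \/ removable lam g)].

Definition letterA (l : nat) (lam : rpart l) : pred (node l) :=
  fun g => `[< addable lam g >].

Definition letterR (l : nat) (lam : rpart l) : pred (node l) :=
  fun g => `[< removable lam g >].

(* Deletes the first factor RA, if any. *)
Fixpoint delete_RA (T : Type) (A R : pred T) (w : seq T) : seq T :=
  match w with
  | x :: (y :: w2) as w1 =>
      if R x && A y then w2 else x :: delete_RA A R w1
  | _ => w
  end.

Definition reduced_signature (e i l : nat) (s : charge l) (lam : rpart l) :
    seq (node l) :=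
  let w := signature e i s lam in
  iter (size w) (delete_RA (letterA lam) (letterR lam)) w.

(* [None] stands for 0. *)
Definition f_tilde (e i l : nat) (s : charge l) (lam : rpart l) :
    option (rpart l) :=
  omap (add_node lam)
    (ohead (rev (filter (letterA lam) (reduced_signature e i s lam)))).

Definition e_tilde (e i l : nat) (s : charge l) (lam : rpart l) :
    option (rpart l) :=
  omap (remove_node lam)
    (ohead (filter (letterR lam) (reduced_signature e i s lam))).

Definition iterate (T : Type) (f : T -> option T) (k : nat) (x : T) :
    option T :=
  iter k (obind f) (Some x).

(* The largest k such that the k-th iterate of f at x is not 0. *)
Definition max_iter (T : Type) (f : T -> option T) (x : T) : nat :=
  xget 0%N [set k | iterate f k x <> None /\
                    forall k', iterate f k' x <> None -> (k' <= k)%N].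

Definition epsilon (e i l : nat) (s : charge l) (lam : rpart l) : nat :=
  max_iter (f_tilde e i s) lam.

Definition phi (e i l : nat) (s : charge l) (lam : rpart l) : nat :=
  max_iter (e_tilde e i s) lam.

(* The iterates below are never 0, so the default value of [odflt] is not
   used. *)
Definition star (e i l : nat) (s : charge l) (lam : rpart l) : rpart l :=
  let ep := epsilon e i s lam in
  let ph := phi e i s lam in
  odflt lam (if (ep <= ph)%N then iterate (e_tilde e i s) (ph - ep) lam
             else iterate (f_tilde e i s) (ep - ph) lam).

(* For N <= m - size lam: the entries >= N of [symbol m lam], in increasing
   order. *)
Definition entries_from (N m : int) (lam : intpart) : seq int :=
  rev [seq beta m lam j | j <- iota 1 `|m - N|].

(* [U] is increasing; see [choose_down] for the other case. *)
Fixpoint choose_up (U V : seq int) : seq int :=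
  if V is y :: V1 then
    let x := head (head 0 U) [seq x <- U | y <= x] in
    x :: choose_up (rem x U) V1
  else [::].

Fixpoint choose_down (V U : seq int) : seq int :=
  if U is x :: U1 then
    let y := last (last 0 V) [seq y <- V | y <= x] in
    y :: choose_down (rem y V) U1
  else [::].

(* The results are only used as sets of entries, so they are not sorted. *)
Definition exchange (U V : seq int) : seq int * seq int :=
  if (size V <= size U)%N then
    let C := choose_up U V in (C, [seq x <- U | x \notin C] ++ V)
  else
    let C := choose_down V U in ([seq y <- V | y \notin C] ++ U, C).

Definition completed (N : int) (W : seq int) : set int :=
  [set x | x < N \/ x \in W].

(* N is the largest integer such that both symbols contain all the integers
   < N; any smaller N gives the same result. *)
Definition Psi (e : nat) (i : 'I_e) (s : charge e) (lam : rpart e) : rpart e :=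
  let k := prev_ord i in
  let N := Num.min (s k - (size (lam k))%:Z) (s i - (size (lam i))%:Z) in
  let UV := exchange (entries_from N (s k) (lam k))
                     (entries_from N (s i) (lam i)) in
  (of_symbols (fun j => if j == k then completed N UV.1
                        else if j == i then completed N UV.2
                        else symbol (s j) (lam j))).1.

Lemma geq_trans : transitive geq.
Proof. by move=> y x z /= xy yz; exact: leq_trans yz xy. Qed.

Lemma sorted_geq_nth (p : seq nat) (j k : nat) :
  sorted geq p -> (j <= k)%N -> (nth 0%N p k <= nth 0%N p j)%N.
Proof.
move=> sp jk; case: (ltnP k (size p)) => [kp|kp]; last by rewrite nth_default.
by have := sorted_leq_nth geq_trans leqnn 0%N sp; apply; rewrite ?inE //; lia.
Qed.

Lemma part_le (lam : intpart) (j k : nat) :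
  (j <= k)%N -> (part lam k <= part lam j)%N.
Proof.
case: lam => p /= pp jk; rewrite /part /=; case/andP: pp => sp _.
by apply: sorted_geq_nth => //; lia.
Qed.

Lemma part_eq0 (lam : intpart) (k : nat) :
  (1 <= k)%N -> (part lam k == 0%N) = (size lam < k)%N.
Proof.
case: lam => p /= pp; case: k => [//|k] _; rewrite /part /= ltnS.
case/andP: pp => _ p0; case: (ltnP k (size p)) => kp.
  by apply/eqP => E; case/negP: p0; rewrite -E mem_nth.
by rewrite nth_default.
Qed.

Lemma eq_intpart (lam mu : intpart) :
  (forall k, (1 <= k)%N -> part lam k = part mu k) -> lam = mu.
Proof.
move=> E; have szE : size lam = size mu.
  have H x : (size lam < x.+1)%N = (size mu < x.+1)%N.
    by rewrite -!part_eq0 ?E.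
  have := H (size lam); have := H (size mu); lia.
by apply: val_inj; apply: (@eq_from_nth _ 0%N) => // i _; apply: (E i.+1).
Qed.

Lemma beta_lt (m : int) (lam : intpart) (j k : nat) :
  (j < k)%N -> beta m lam k < beta m lam j.
Proof. by rewrite /beta => jk; have := part_le lam (ltnW jk); lia. Qed.

Lemma symbol_inj (m m' : int) (lam lam' : intpart) :
  symbol m lam = symbol m' lam' -> lam = lam' /\ m = m'.
Proof.
move=> E.
have half m1 m2 l1 l2 k : symbol m1 l1 = symbol m2 l2 -> (1 <= k)%N ->
    (forall j, (1 <= j < k)%N -> beta m1 l1 j = beta m2 l2 j) ->
    beta m1 l1 k <= beta m2 l2 k.
  move=> Eh k0 IH; have : symbol m2 l2 (beta m1 l1 k) by rewrite -Eh; exists k.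
  case=> j j0 ej; rewrite ej; case: (ltnP j k) => jk.
    by have := beta_lt m1 l1 jk; rewrite (IH j) ?j0 // -ej ltxx.
  by move: jk; rewrite leq_eqVlt => /predU1P[->//|/beta_lt h]; apply: ltW.
have eqb k : (1 <= k)%N -> beta m lam k = beta m' lam' k.
  elim/ltn_ind: k => k IH k0; apply: le_anti; apply/andP; split.
    by apply: half => // j /andP[j0 jk]; apply: IH.
  by apply: half => // j /andP[j0 jk]; rewrite IH.
have mm : m = m'.
  pose k := (size lam + size lam').+1.
  have := eqb k isT; rewrite /beta.
  have /eqP -> : part lam k == 0%N by rewrite part_eq0 // /k; lia.
  have /eqP -> : part lam' k == 0%N by rewrite part_eq0 // /k; lia.
  lia.
split=> //; apply: eq_intpart => k k0; have := eqb k k0; rewrite /beta; lia.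
Qed.

Lemma nth_filter_pos (p : seq nat) (k : nat) :
  sorted geq p -> nth 0%N [seq x <- p | x != 0%N] k = nth 0%N p k.
Proof.
elim: p k => [//|x p IH] k sp /=; have sp' := path_sorted sp.
case: eqP => [x0|_] /=; last by case: k => [//|k] /=; apply: IH.
have z j : nth 0%N (x :: p) j = 0%N.
  by have := sorted_geq_nth sp (leq0n j); rewrite /= x0; lia.
by rewrite IH // z; apply: (z k.+1).
Qed.

Lemma intpart_of_seq (p : seq nat) :
  sorted geq p -> exists lam : intpart, forall k, part lam k.+1 = nth 0%N p k.
Proof.
move=> sp; have pp : is_intpart [seq x <- p | x != 0%N].
  by rewrite /is_intpart (sorted_filter geq_trans) //= mem_filter eqxx.
by exists (IntPart pp) => k; rewrite /part /= nth_filter_pos.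
Qed.

(* The partition and the charge of a set of integers that contains all the
   integers < N and none of those >= N + K. *)
Lemma symbol_surj (N : int) (K : nat) (S : set int) :
  (forall x, x < N -> S x) -> (forall x, S x -> x < N + K%:Z) ->
  exists lam, symbol (N + \sum_(t < K) `[< S (N + t%:Z) >]%:R) lam = S.
Proof.
elim: K S => [|K IH] S lo hi.
  exists empty_part; rewrite big_ord0 addr0; apply/seteqP; split=> x.
    move=> [j j0 ->]; apply: lo; rewrite /beta /part nth_nil; lia.
  move=> /hi; rewrite addr0 => xN; exists `|N - x|%N; first by lia.
  by rewrite /beta /part nth_nil; lia.
have Nltz (t : 'I_K) : (N + t%:Z == N + K%:Z) = false.
  by have := ltn_ord t; lia.
rewrite big_ord_recr /=; case: asboolP => SK; last first.
  rewrite addr0; apply: IH => // x Sx; have := hi x Sx.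
  suff /eqP : x <> N + K%:Z by lia.
  by move=> xE; apply: SK; rewrite -xE.
have [] := IH (S `\ (N + K%:Z)).
- by move=> x xN; split; [exact: lo|move=> /= xE; move: xN; rewrite xE; lia].
- by move=> x [/hi]; rewrite /=; move=> h /eqP; lia.
have -> : \sum_(t < K) `[< (S `\ (N + K%:Z)) (N + t%:Z) >]%:R =
          \sum_(t < K) `[< S (N + t%:Z) >]%:R :> int.
  apply: eq_bigr => t _; congr (_%:R); congr nat_of_bool.
  apply: asbool_equiv_eq; split=> [[]//|h]; split=> //= /eqP.
  by rewrite Nltz.
move=> lam.
set m' := N + \sum_(t < K) _ => ES.
have top : beta m' lam 1 < N + K%:Z.
  have [/hi] : (S `\ (N + K%:Z)) (beta m' lam 1) by rewrite -ES; exists 1%N.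
  by rewrite /=; move=> h /eqP; lia.
have sp : sorted geq (absz (N + K%:Z - m')%R :: lam).
  case: lam top {ES} => p /= pp; rewrite /beta /part /=.
  case/andP: pp; case: p => [//|x p] /= -> _ h; rewrite andbT; lia.
have [mu muE] := intpart_of_seq sp.
have mE : (N + \sum_(t < K) `[< S (N + t%:Z) >]%:R + 1%:R) = m' + 1 by [].
exists mu; rewrite addrA mE; clearbody m'.
have bS j : (1 <= j)%N -> beta (m' + 1) mu j.+1 = beta m' lam j.
  by case: j => // j _; rewrite /beta muE /= /part /=; lia.
have b1 : beta (m' + 1) mu 1 = N + K%:Z.
  by rewrite /beta muE /=; move: top; rewrite /beta; lia.
apply/seteqP; split=> x.
  case=> -[//|[|j]] _ ->; first by rewrite b1.
  by rewrite bS //; have [] : (S `\ (N + K%:Z)) (beta m' lam j.+1)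
     by rewrite -ES; exists j.+1.
move=> Sx; have [->|xK] := eqVneq x (N + K%:Z); first by exists 1%N.
have : symbol m' lam x by rewrite ES; split=> //=; apply/eqP.
by case=> j j0 ->; exists j.+1 => //; rewrite bS.
Qed.

Lemma symbol_bound (m : int) (lam : intpart) :
  exists B : nat, forall C : nat, (B <= C)%N ->
    (forall x, x < - C%:Z -> symbol m lam x) /\
    (forall x, symbol m lam x -> x < C%:Z).
Proof.
exists (`|m| + size lam + part lam 1)%N => C BC; split=> x.
  move=> xC; exists `|m - x|%N; first by lia.
  rewrite /beta; have /eqP -> : part lam `|m - x| == 0%N.
    by rewrite part_eq0; lia.
  lia.
by case=> j j0 ->; rewrite /beta; have := part_le lam j0; lia.
Qed.

Lemma symbolK (m : int) (lam : intpart) : of_symbol (symbol m lam) = (lam, m).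
Proof.
apply: xget_unique => // -[mu n] /= E.
by have [-> ->] := symbol_inj E.
Qed.

Lemma of_symbolK (B : nat) (S : set int) :
  (forall x, x < - B%:Z -> S x) -> (forall x, S x -> x < B%:Z) ->
  symbol (of_symbol S).2 (of_symbol S).1 = S.
Proof.
move=> lo hi; have [//|x Sx|lam <-] := @symbol_surj (- B%:Z) (B + B) S.
  by have := hi x Sx; lia.
by rewrite symbolK.
Qed.

(* The charge of [symbol m lam], obtained by counting. *)
Lemma symbol_charge (N m : int) (K : nat) (lam : intpart) :
  (forall x, x < N -> symbol m lam x) ->
  (forall x, symbol m lam x -> x < N + K%:Z) ->
  m = N + \sum_(t < K) `[< symbol m lam (N + t%:Z) >]%:R.
Proof.
by move=> lo hi; have [mu] := symbol_surj lo hi => /symbol_inj [].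
Qed.

Lemma sum_reindex (r a b C : nat) (phi : 'I_r -> int -> int) (F : int -> int) :
  (forall j k x y, phi j x = phi k y -> j = k /\ x = y) ->
  (forall y, exists j x, phi j x = y) ->
  (forall j x z, (phi j x < b%:Z * z) = (x < a%:Z * z)) ->
  \sum_j \sum_(t < a * C + a * C) F (phi j (- (a%:Z * C%:Z) + t%:Z)) =
  \sum_(t < b * C + b * C) F (- (b%:Z * C%:Z) + t%:Z).
Proof.
move=> inj surj lt.
pose rg (c : nat) := [seq - (c%:Z * C%:Z) + t%:Z | t <- iota 0 (c * C + c * C)].
have rgP c x : (x \in rg c) = (- (c%:Z * C%:Z) <= x) && (x < c%:Z * C%:Z).
  apply/mapP/andP => [[t] | [h1 h2]].
    by rewrite mem_iota => /andP[_ h] ->; split; lia.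
  by exists (absz (x + c%:Z * C%:Z)); [rewrite mem_iota; lia|lia].
have rgU c : uniq (rg c) by rewrite map_inj_uniq ?iota_uniq // => x y; lia.
have rgE c (G : int -> int) :
    \sum_(t < c * C + c * C) G (- (c%:Z * C%:Z) + t%:Z) = \sum_(x <- rg c) G x.
  rewrite big_map -(big_mkord xpredT (fun t => G (- (c%:Z * C%:Z) + t%:Z))).
  by rewrite /index_iota subn0.
rewrite rgE; under eq_bigr => j _ do rewrite (rgE a (fun x => F (phi j x))).
rewrite -big_enum /= -(@big_allpairs_dep _ _ _ _ _ _ phi (enum _) (fun=> rg a)); apply: perm_big; apply: uniq_perm.
- apply: allpairs_uniq; rewrite ?enum_uniq //.
  by move=> [j x] [k y] _ _ /= /inj [-> ->].
- exact: rgU.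
move=> y; apply/allpairsP/idP => [[[j x] /= [_ hx ->]]|hy].
  by move: hx; rewrite !rgP lt !leNgt -!mulrN lt.
have [j [x xy]] := surj y; exists (j, x) => /=; split=> //.
  by rewrite mem_enum.
by move: hy; rewrite -xy !rgP lt !leNgt -!mulrN lt.
Qed.

Lemma quotient_bij (r a b : nat) (m : int) (phi : 'I_r -> int -> int)
    (f := fun lam => of_symbols (fun j => [set x | symbol m lam (phi j x)])) :
  (0 < a)%N -> (0 < b)%N ->  (r * a = b)%N ->
  (forall j k x y, phi j x = phi k y -> j = k /\ x = y) ->
  (forall y, exists j x, phi j x = y) ->
  (forall j x z, (phi j x < b%:Z * z) = (x < a%:Z * z)) ->
  (forall lam j, symbol ((f lam).2 j) ((f lam).1 j) =
                 [set x | symbol m lam (phi j x)]) /\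
  set_bij [set: intpart] [set x | charges m x.2] f.
Proof.
move=> a0 b0 rab inj surj lt.
have bnd n lam : exists C : nat,
    [/\ forall x, x < - (b%:Z * C%:Z) -> symbol n lam x,
        forall x, symbol n lam x -> x < b%:Z * C%:Z,
        forall j x, x < - (a%:Z * C%:Z) -> symbol n lam (phi j x)
      & forall j x, symbol n lam (phi j x) -> x < a%:Z * C%:Z].
  have [B hB] := symbol_bound n lam; exists B.
  have [|lo hi] := hB (b * B)%N; first by rewrite leq_pmull.
  split=> [x|x|j x|j x].
  - by rewrite -PoszM; apply: lo.
  - by move/hi; rewrite PoszM.
  - by rewrite -mulrN -(lt j) mulrN -PoszM; apply: lo.
  - by move/hi; rewrite PoszM lt.
have sumP n lam (Lam : rpart r) (s : charge r) :
    (forall j, symbol (s j) (Lam j) = [set x | symbol n lam (phi j x)]) ->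
    \sum_j s j = n.
  move=> E; have [C [lo hi loj hij]] := bnd n lam.
  have -> : n = - (b%:Z * C%:Z) + \sum_(t < b * C + b * C)
      `[< symbol n lam (- (b%:Z * C%:Z) + t%:Z) >]%:R.
    by apply: symbol_charge => // x /hi; lia.
  rewrite -(@sum_reindex r a b C phi (fun y => `[< symbol n lam y >]%:R) inj surj lt).
  have sE j : s j = - (a%:Z * C%:Z) + \sum_(t < a * C + a * C)
      `[< symbol n lam (phi j (- (a%:Z * C%:Z) + t%:Z)) >]%:R.
    rewrite (@symbol_charge (- (a%:Z * C%:Z)) (s j) (a * C + a * C) (Lam j)).
    - by rewrite E.
    - by rewrite E; apply: loj.
    - by rewrite E => x /hij; lia.
  under eq_bigr => j _ do rewrite sE.
  rewrite big_split /= sumr_const card_ord; congr (_ + _).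
  by rewrite -rab; lia.
have fE lam j : symbol ((f lam).2 j) ((f lam).1 j) =
                [set x | symbol m lam (phi j x)].
  have [C [_ _ loj hij]] := bnd m lam.
  rewrite /f /of_symbols /= !ffunE; apply: (@of_symbolK (a * C)) => x.
    by rewrite PoszM; apply: loj.
  by move/hij; rewrite PoszM.
split=> //; split.
- by move=> lam _ /=; rewrite /charges /=; apply: sumP (fE lam).
- move=> lam mu _ _ E; suff /symbol_inj[] : symbol m lam = symbol m mu by [].
  apply/funext => y; have [j [x <-]] := surj y.
  by have := fE lam j; rewrite E fE => /(congr1 (fun S => S x)).
move=> [Lam s] /= sm.
pose S := [set y | exists j x, phi j x = y /\ symbol (s j) (Lam j) x].
have SE j : [set x | S (phi j x)] = symbol (s j) (Lam j).
  apply/funext => x; apply/propext; split; last by exists j, x.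
  by case=> k [y [/inj[-> ->]]].
have [C [lo hi]] : exists C : nat, (forall x, x < - (b * C)%N%:Z -> S x) /\
                      (forall x, S x -> x < (b * C)%N%:Z).
  have /choice[B hB] := fun j => symbol_bound (s j) (Lam j).
  exists (\max_j B j)%N.
  have BC j : (B j <= a * \max_j B j)%N.
    by apply: leq_trans (leq_pmull _ a0); apply: leq_bigmax.
  split=> y.
    have [j [x <-]] := surj y.
    rewrite PoszM -mulrN lt mulrN -PoszM => xl; exists j, x; split=> //.
    by have [h _] := hB j _ (BC j); apply: h.
  case=> j [x [<- Sx]]; rewrite PoszM lt -PoszM.
  by have [_ h] := hB j _ (BC j); apply: h.
have ES := of_symbolK lo hi; move: (of_symbol S) ES => [lam n] /= ES.
have nm : n = m.
  by rewrite -sm; apply/esym/(sumP n lam Lam) => j; rewrite ES SE.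
exists lam => //; rewrite /f -nm ES; apply/eqP; rewrite xpair_eqE.
apply/andP; split; apply/eqP/ffunP => j; rewrite ffunE SE symbolK //.
Qed.

Lemma tau_e_ok (e : nat) (m : int) : (1 <= e)%N ->
  (forall lam (j : 'I_e), symbol ((tau_e e m lam).2 j) ((tau_e e m lam).1 j) =
                 residue_symbol m lam j) /\
  set_bij [set: intpart] [set x | charges m x.2] (tau_e e m).
Proof.
move=> e0.
apply: (@quotient_bij e 1 e m (fun j k => j%:Z + k * e%:Z)) => //.
- by rewrite muln1.
- move=> j k x y E; have := ltn_ord j; have := ltn_ord k => hk hj.
  have xy : x = y by nia.
  by split=> //; apply: val_inj => /=; move: E; rewrite xy; lia.
- move=> y; have h : (absz (y %% e%:Z)%Z < e)%N.
    have := ltz_pmod y (d := e%:Z); have := modz_ge0 y (d := e%:Z); lia.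
  exists (Ordinal h), (y %/ e%:Z)%Z => /=.
  rewrite {3}(divz_eq y e%:Z); have := modz_ge0 y (d := e%:Z); lia.
move=> j x z; have := ltn_ord j => hj; apply/idP/idP => h; nia.
Qed.

Lemma tau_e_bij (e : nat) (m : int) : (1 <= e)%N ->
  set_bij [set: intpart] [set x | charges m x.2] (tau_e e m).
Proof. by move/(tau_e_ok m) => []. Qed.

Lemma tau_eE (e : nat) (m : int) (lam : intpart) (j : 'I_e) : (1 <= e)%N ->
  symbol ((tau_e e m lam).2 j) ((tau_e e m lam).1 j) = residue_symbol m lam j.
Proof. by move/(tau_e_ok m) => []. Qed.

Lemma level_symbolE (e l : nat) (m : int) (lam : intpart) (d : 'I_l) :
  (1 <= e)%N ->
  level_symbol e m lam d =
  [set x | symbol m lam ((x %% e%:Z)%Z + e%:Z * d%:Z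
                         + e%:Z * l%:Z * (x %/ e%:Z)%Z)].
Proof.
move=> e0; apply/seteqP; split=> x.
  case=> c [q [ce Sb ->]] /=.
  have -> : ((c%:Z + e%:Z * q) %% e%:Z)%Z = c%:Z.
    by rewrite mulrC addrC modzMDl modz_small //; lia.
  have -> // : ((c%:Z + e%:Z * q) %/ e%:Z)%Z = q.
  by rewrite mulrC divzDr ?dvdz_mull // mulzK ?divz_small ?add0r //; lia.
move=> /= Sb; have h1 := modz_ge0 x (d := e%:Z).
have h2 := ltz_pmod x (d := e%:Z); have h3 := divz_eq x e%:Z.
exists (absz (x %% e%:Z)%Z), (x %/ e%:Z)%Z; split.
- by move: h1 h2; lia.
- by have -> : (absz (x %% e%:Z)%Z)%:Z = (x %% e%:Z)%Z by move: h1; lia.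
by move: h1 h3; lia.
Qed.

Lemma tau_l_ok (e l : nat) (m : int) : (1 <= e)%N -> (1 <= l)%N ->
  (forall lam (j : 'I_l), symbol ((tau_l e l m lam).2 j) ((tau_l e l m lam).1 j)
                          = level_symbol e m lam (rev_ord j)) /\
  set_bij [set: intpart] [set x | charges m x.2] (tau_l e l m).
Proof.
move=> e0 l0; pose phi (j : 'I_l) (x : int) := (x %% e%:Z)%Z
  + e%:Z * (rev_ord j : nat)%:Z + e%:Z * l%:Z * (x %/ e%:Z)%Z.
have div x : exists (q : int) (c : nat),
    [/\ (c < e)%N, x = c%:Z + e%:Z * q, (x %/ e%:Z)%Z = q &
        (x %% e%:Z)%Z = c%:Z].
  have h1 := modz_ge0 x (d := e%:Z); have h2 := ltz_pmod x (d := e%:Z).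
  have h3 := divz_eq x e%:Z; exists (x %/ e%:Z)%Z, (absz (x %% e%:Z)%Z).
  by split; move: h1 h2 h3; lia.
have levE lam j : level_symbol e m lam (rev_ord j) =
    [set x | symbol m lam (phi j x)] by rewrite level_symbolE.
have tauE : tau_l e l m =
    (fun lam => of_symbols (fun j => [set x | symbol m lam (phi j x)])).
  apply/funext => lam; rewrite /tau_l; congr of_symbols.
  by apply/funext => j; rewrite levE.
have [] := @quotient_bij l e (l * e) m phi.
- by [].
- by rewrite muln_gt0 l0.
- by [].
- move=> j k x y; rewrite /phi.
  have [q [c [ce -> -> ->]]] := div x; have [q' [c' [ce' -> -> ->]]] := div y.
  have := ltn_ord (rev_ord j); have := ltn_ord (rev_ord k).
  set d := nat_of_ord (rev_ord j); set d' := nat_of_ord (rev_ord k).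
  move=> dl' dl E.
  have E1 : c%:Z - c'%:Z = e%:Z * ((d'%:Z + l%:Z * q') - (d%:Z + l%:Z * q)).
    by move: E; lia.
  have E2 : d'%:Z + l%:Z * q' = d%:Z + l%:Z * q by nia.
  have qq : q = q' by nia.
  have dd : d = d' by move: E2; rewrite qq; lia.
  split; last by move: E1; rewrite E2 qq; lia.
  by apply: rev_ord_inj; apply: val_inj.
- move=> y; pose u := (y %/ e%:Z)%Z.
  have h1 := modz_ge0 u (d := l%:Z); have h2 := ltz_pmod u (d := l%:Z).
  have hd : (absz (u %% l%:Z)%Z < l)%N by move: h1 h2; lia.
  exists (rev_ord (Ordinal hd)), ((y %% e%:Z)%Z + e%:Z * (u %/ l%:Z)%Z).
  rewrite /phi rev_ordK /=.
  have g1 := modz_ge0 y (d := e%:Z); have g2 := ltz_pmod y (d := e%:Z).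
  have [q [c [ce E Eq Ec]]] := div ((y %% e%:Z)%Z + e%:Z * (u %/ l%:Z)%Z).
  have [E1 E2] : q = (u %/ l%:Z)%Z /\ c%:Z = (y %% e%:Z)%Z.
    have E3 : q = (u %/ l%:Z)%Z by move: g1 g2 E; nia.
    by split=> //; move: E; rewrite E3; lia.
  rewrite Eq Ec E1 E2; have := divz_eq y e%:Z; have := divz_eq u l%:Z.
  rewrite -/u; move: h1; nia.
- move=> j x z; rewrite /phi; have [q [c [ce -> -> ->]]] := div x.
  have := ltn_ord (rev_ord j); set d := nat_of_ord (rev_ord j) => dl.
  have aux (e1 c1 : nat) (u v : int) : (c1 < e1)%N ->
      (c1%:Z + e1%:Z * u < e1%:Z * v) = (u < v).
    by move=> h; apply/idP/idP => g; nia.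
  rewrite (aux e c q z) // -(aux l d q z) // -(aux e c _ (l%:Z * z)) //.
  by rewrite PoszM mulrDr !mulrA !addrA [l%:Z * _]mulrC.
by move=> E bij; rewrite tauE; split=> // lam j; rewrite levE E.
Qed.

Lemma tau_l_bij (e l : nat) (m : int) : (1 <= e)%N -> (1 <= l)%N ->
  set_bij [set: intpart] [set x | charges m x.2] (tau_l e l m).
Proof. by move=> e0 l0; have [] := tau_l_ok m e0 l0. Qed.

Lemma tau_lE (e l : nat) (m : int) (lam : intpart) (j : 'I_l) :
  (1 <= e)%N -> (1 <= l)%N ->
  symbol ((tau_l e l m lam).2 j) ((tau_l e l m lam).1 j) =
  level_symbol e m lam (rev_ord j).
Proof. by move=> e0 l0; have [] := tau_l_ok m e0 l0. Qed.

Lemma diagram_inj (l : nat) : injective (@diagram l).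
Proof.
have half (lam mu : rpart l) c k : diagram lam = diagram mu -> (1 <= k)%N ->
    (part (lam c) k <= part (mu c) k)%N.
  move=> E k1; case: (posnP (part (lam c) k)) => [->//|p0].
  have : diagram lam (k, part (lam c) k, c) by split.
  by rewrite E => -[].
move=> lam mu E; apply/ffunP => c; apply: eq_intpart => k k1.
by apply/eqP; rewrite eqn_leq !half.
Qed.

Lemma addable_bounds (l : nat) (lam : rpart l) (a b : nat) (c : 'I_l) :
  addable lam (a, b, c) ->
  [/\ (1 <= a)%N, b = (part (lam c) a).+1 &
      (1 < a)%N -> (b <= part (lam c) a.-1)%N].
Proof.
case=> nd [mu E].
have muP a' b' c' : diagram mu (a', b', c') <->
    (a', b', c') = (a, b, c) \/ diagram lam (a', b', c') by rewrite E.
have [a1 b1 bm] : diagram mu (a, b, c) by rewrite muP; left.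
have le_ab a' b' : (1 <= a' <= a)%N -> (1 <= b' <= b)%N ->
    (a', b') <> (a, b) -> (b' <= part (lam c) a')%N.
  move=> /andP[a'1 a'a] /andP[b'1 b'b] ne.
  have : diagram mu (a', b', c).
    by split=> //; apply: leq_trans (part_le (mu c) a'a); apply: leq_trans bm.
  by rewrite muP => -[[? ?]|[]//]; case: ne; congr pair.
split=> //; last first.
  by move=> a2; apply: le_ab; [lia|lia|move=> [h]; lia].
apply/eqP; rewrite eqn_leq; apply/andP; split.
  case: (ltnP 1 b) => [b2|]; last lia.
  suff : (b.-1 <= part (lam c) a)%N by lia.
  by apply: le_ab; [lia|lia|move=> [h]; lia].
by rewrite ltnNge; apply/negP => h; apply: nd.
Qed.

Lemma removable_bounds (l : nat) (lam : rpart l) (a b : nat) (c : 'I_l) :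
  removable lam (a, b, c) ->
  [/\ (1 <= a)%N, (1 <= b)%N, b = part (lam c) a &
      (part (lam c) a.+1 < b)%N].
Proof.
case=> -[a1 b1 bl] [mu E].
have muP a' b' c' : diagram mu (a', b', c') <->
    diagram lam (a', b', c') /\ (a', b', c') <> (a, b, c) by rewrite E.
have key a' b' : (a <= a')%N -> (b <= b')%N -> diagram lam (a', b', c) ->
    (a', b') = (a, b).
  move=> aa bb dl; apply: contrapT => ne.
  have [_ _ h] : diagram mu (a', b', c).
    by rewrite muP; split=> // -[? ?]; apply: ne; congr pair.
  have : diagram mu (a, b, c).
    by split=> //; apply: leq_trans bb (leq_trans h _); apply: part_le.
  by rewrite muP => -[_]; apply.
split=> //.
  apply/eqP; rewrite eqn_leq bl /= leqNgt; apply/negP => h.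
  have dl : diagram lam (a, b.+1, c) by split.
  by have [] := key _ _ (leqnn a) (leqnSn b) dl; lia.
rewrite ltnNge; apply/negP => h.
have dl : diagram lam (a.+1, b, c) by split.
by have [] := key _ _ (leqnSn a) (leqnn b) dl; lia.
Qed.

Lemma node_lt_trans (l : nat) (s : charge l) : transitive (node_lt s).
Proof. by move=> y x z; rewrite /node_lt; lia. Qed.

Lemma node_lt_irr (l : nat) (s : charge l) : irreflexive (node_lt s).
Proof. by move=> x; rewrite /node_lt; lia. Qed.

Lemma node_lt_total (l : nat) (s : charge l) (lam : rpart l) (g h : node l) :
  addable lam g \/ removable lam g -> addable lam h \/ removable lam h ->
  [|| g == h, node_lt s g h | node_lt s h g].
Proof.
wlog : g h / (g.1.1 <= h.1.1)%N => [H Hg Hh|].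
  case: (leqP g.1.1 h.1.1) => [|/ltnW] gh; first by move=> *; exact: H.
  by rewrite eq_sym (orbC (node_lt s g h)); exact: H.
case: g => -[a b] c; case: h => -[a' b'] c' /= aa Hg Hh.
rewrite /node_lt /=; have [cc|cc] := eqVneq c c'; last first.
  by have : nat_of_ord c != c' by []; lia.
rewrite -{}cc in Hh *; move: aa; rewrite leq_eqVlt => /predU1P[aE|aa].
  rewrite -{}aE in Hh *; have [->|bb] := eqVneq b b'; first by rewrite eqxx.
  by lia.
suff : b%:Z - a%:Z <> b'%:Z - a'%:Z by lia.
have a1 : (1 <= a)%N.
  by case: Hg => [/addable_bounds[]|/removable_bounds[]].
move=> E; have h1 := part_le (lam c) (ltnW aa).
have h2 := part_le (lam c) aa.
case: Hh => [/addable_bounds[_ Eb' h3]|/removable_bounds[_ _ Eb' h3]].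
  have h4 : (b' <= part (lam c) a'.-1)%N by apply: h3; lia.
  have h5 : (part (lam c) a'.-1 <= part (lam c) a)%N by apply: part_le; lia.
  case: Hg => [/addable_bounds[_ Eb _]|/removable_bounds[_ _ Eb _]]; lia.
by case: Hg => [/addable_bounds[_ Eb _]|/removable_bounds[_ _ Eb _]]; lia.
Qed.

Lemma signatureP (e i l : nat) (s : charge l) (lam : rpart l) :
  sorted (node_lt s) (signature e i s lam) /\
  forall g, g \in signature e i s lam <->
            has_residue e i s g /\ (addable lam g \/ removable lam g).
Proof.
pose P g := `[< has_residue e i s g /\ (addable lam g \/ removable lam g) >].
pose box := [seq (ab, c) | ab <- [seq (a, b) |
    a <- iota 0 (\max_c size (lam c)).+2,
    b <- iota 0 (\max_c part (lam c) 1).+2], c <- enum 'I_l].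
have boxP g : P g -> g \in box.
  case: g => -[a b] c /asboolP[_ H]; rewrite /box.
  apply/allpairsP; exists ((a, b), c); split=> //; last by rewrite mem_enum.
  have mx := leq_bigmax (F := fun c => size (lam c)) c.
  have mx1 := leq_bigmax (F := fun c => part (lam c) 1) c.
  have szE k : (1 <= k)%N -> (1 <= part (lam c) k)%N -> (k <= size (lam c))%N.
    by move=> k1; rewrite lt0n part_eq0 // -leqNgt.
  have [a1 al bl] : [/\ (1 <= a)%N, (a <= (size (lam c)).+1)%N &
                     (b <= (part (lam c) 1).+1)%N].
    case: H => [/addable_bounds[a1 -> h]|/removable_bounds[a1 b1 -> h]].
      split=> //; last by rewrite ltnS; apply: part_le.
      case: (ltnP 1 a) => [a2|]; last by lia.
      by have := szE a.-1; have := h a2; lia.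
    split=> //; last by apply/leqW/part_le.
    by apply/leqW/szE => //; lia.
  by apply/allpairsP; exists (a, b); split=> //; rewrite mem_iota /fst /snd; lia.
pose le : rel (node l) := fun g h => ~~ node_lt s h g.
have le_total : total le by move=> g h; rewrite /le /node_lt; lia.
have le_trans : transitive le by move=> y x z; rewrite /le /node_lt; lia.
pose w := sort le (undup (filter P box)).
have wP g : g \in w = P g.
  by rewrite mem_sort mem_undup mem_filter andb_idr // => /boxP.
rewrite /signature; set Q := (X in xget _ X).
change (Q (xget [::] Q)); apply: (@xgetI _ _ _ w); split; last first.
  by move=> g; rewrite wP; split=> /asboolP.
have wU : uniq w by rewrite sort_uniq undup_uniq.
have : sorted le w by apply: sort_sorted.
have : all P w by apply/allP => g; rewrite wP.
elim: w wU {wP} => [//|g [|h w] IH] //= /andP[ngw wU] /andP[Pg Pw] /andP[gh ws].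
have /= -> := IH wU Pw ws; rewrite andbT; case/andP: Pw => /asboolP[_ Hh] _.
case/asboolP: Pg => _ Hg; have := node_lt_total s Hg Hh.
move: gh ngw; rewrite /le inE negb_or.
by case: (g == h) => //; case: (node_lt s h g) => //; rewrite orbF.
Qed.

Lemma signature_unique (e i l : nat) (s : charge l) (lam : rpart l) w :
  sorted (node_lt s) w ->
  (forall g, g \in w <->
             has_residue e i s g /\ (addable lam g \/ removable lam g)) ->
  w = signature e i s lam.
Proof.
move=> sw wP; have [ss sP] := signatureP e i s lam.
apply: (irr_sorted_eq (@node_lt_trans _ s) (@node_lt_irr _ s)) => // g.
by apply/idP/idP => [/wP/sP|/sP/wP].
Qed.

Lemma add_nodeP (l : nat) (lam : rpart l) (g : node l) :
  addable lam g -> diagram (add_node lam g) = g |` diagram lam.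
Proof. by case=> _ /(xgetPex lam). Qed.

Lemma remove_nodeP (l : nat) (lam : rpart l) (g : node l) :
  removable lam g -> diagram (remove_node lam g) = diagram lam `\ g.
Proof. by case=> _ /(xgetPex lam). Qed.

Lemma entries_fromP (N m : int) (lam : intpart) :
  N <= m - (size lam)%:Z ->
  sorted <%R (entries_from N m lam) /\
  forall x, x \in entries_from N m lam <-> N <= x /\ symbol m lam x.
Proof.
move=> Nm; split.
  rewrite rev_sorted sorted_map.
  apply: sub_sorted (iota_ltn_sorted 1 _) => j k jk /=; exact: beta_lt.
have small k : (size lam < k)%N -> beta m lam k = m - k%:Z.
  move=> h; rewrite /beta; have /eqP -> : part lam k == 0%N.
    by rewrite part_eq0 //; lia.
  lia.
move=> x; rewrite mem_rev; split.
  case/mapP=> j; rewrite mem_iota => /andP[j1 jN] ->; split; last by exists j.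
  case: (ltnP (size lam) j) => hj; first by rewrite small //; lia.
  by rewrite /beta; lia.
case=> Nx [j j1 xE]; apply/mapP; exists j => //; rewrite mem_iota j1 /=.
case: (ltnP (size lam) j) => hj; last by lia.
by move: Nx; rewrite xE small //; lia.
Qed.

Lemma tau_e_invK (e : nat) (m : int) (x : rpart e * charge e) :
  (1 <= e)%N -> charges m x.2 -> tau_e e m (tau_e_inv m x) = x.
Proof.
move=> e0 xm; have [_ _ surj] := tau_e_bij m e0.
by apply: pinvK; apply/mem_set/surj.
Qed.

Lemma tau_l_invK (e l : nat) (m : int) (x : rpart l * charge l) :
  (1 <= e)%N -> (1 <= l)%N -> charges m x.2 ->
  tau_l e l m (tau_l_inv e m x) = x.
Proof.
move=> e0 l0 xm; have [_ _ surj] := tau_l_bij m e0 l0.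
by apply: pinvK; apply/mem_set/surj.
Qed.

Lemma sigma_act_charges (e : nat) (m : int) (i : 'I_e) (s : charge e) :
  charges m s -> charges m (sigma_act i s).
Proof.
rewrite /charges /= => <-; rewrite [RHS](reindex_perm (tperm (prev_ord i) i)).
by apply: eq_bigr => j _; rewrite ffunE.
Qed.

(* Main.v *)
Require Import Defs.
From HB Require Import structures.
From mathcomp Require Import all_boot all_order all_algebra.
From mathcomp Require Import boolp classical_sets functions.
From mathcomp Require Import perm zify.
Import Order.TTheory GRing.Theory Num.Theory.
Local Open Scope classical_set_scope.
Local Open Scope ring_scope.

(** Put X for the symbol of lambda and write its entries as c + e k with
    0 <= c < e: the k occurring with a given c form the runner Y^c.  Let
    P = Y^(i-1) and Q = Y^i.  A node of lambda^l of residue i, lying in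
    component c with content i + e q, is recorded by the integer
    k = (l - 1 - c) + l q ([nodepos]).  Adding such a node moves a bead from
    i - 1 + e k to i + e k, so addable i-nodes are the elements of P \ Q and
    removable ones those of Q \ P, and the order on nodes is the order of
    the integers k ([wordP], [nodepos_mono]).  Hence the signature is the
    symmetric difference of P and Q read in increasing order, with letter A on
    P \ Q and R on Q \ P.  Both sides of the theorem move a set D of integers
    from one of P, Q to the other, and leave the other runners alone; the point
    is that they move the same D.

    For the star operation, match every A with the last unmatched R before it.
    The unmatched letters form A^p R^q.  A crystal operator flips one letter at
    the border between the two blocks and changes no match ([scan_flip]), so
    star moves the last p - q unmatched letters A if p >= q and the first q - p
    unmatched letters R if p <= q ([star_up], [star_down]).

    For Psi, the greedy choice is a matching on a circle: when no larger entry
    is left, it starts again from the smallest one.  When P has at least as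
    many entries as Q, an entry x of P is left over precisely when each cyclic
    interval ending at x has more entries of P than of Q ([choose_upP]).  This
    criterion does not depend on the order in which the entries of Q are
    treated, so the other case follows from it by the symmetry x |-> - x
    ([choose_downP]).

    The letters moved by star satisfy the criterion, by counting letters in
    prefixes of the signature ([scan_size]); there are as many of them as there
    are entries left over by the greedy choice, so the two sets agree
    ([choose_up_scan], [choose_down_scan]). *)

Set Implicit Arguments.
Unset Strict Implicit.
Unset Printing Implicit Defensive.

(** * Cancelling RA with a stack *)

Section Scan.
Variables (T : eqType).
Implicit Types (A R : pred T) (w : seq T).

(** The state consists of the unmatched letters A and the unmatched letters R
    read so far, the most recent first; letters outside [A] count as R.  A new
    A cancels the most recent unmatched R, if there is one. *)
Definition scan_step A (st : seq T * seq T) (x : T) : seq T * seq T :=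
  let: (a, b) := st in
  if A x then (if b is _ :: b' then (a, b') else (x :: a, [::]))
  else (a, x :: b).

Definition scan A w := foldl (scan_step A) ([::], [::]) w.

Lemma scan_rcons A w x : scan A (rcons w x) = scan_step A (scan A w) x.
Proof. by rewrite /scan -cats1 foldl_cat. Qed.

Lemma eq_in_scan A A' w : {in w, A =1 A'} -> scan A w = scan A' w.
Proof.
elim/last_ind: w => [//|w x IH] E; rewrite !scan_rcons IH => [|y yw].
  by rewrite /scan_step E // mem_rcons mem_head.
by apply: E; rewrite mem_rcons inE yw orbT.
Qed.

(** The machine forgets an adjacent pair RA as soon as it has read it; this is
    why the final state can be computed from the reduced word. *)
Lemma delete_RA_scan A R w st : {in w, forall x, R x = ~~ A x} ->
  foldl (scan_step A) st (delete_RA A R w) = foldl (scan_step A) st w.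
Proof.
elim: w st => [//|x [//|y w] IH] st RA.
rewrite [delete_RA _ _ (_ :: _ :: _)]/=; case: ifP => [/andP[Rx Ay]|_].
  have nAx : A x = false by apply/negbTE; rewrite -RA ?mem_head.
  by case: st => a b /=; rewrite nAx /= Ay.
rewrite (lock delete_RA) /= -lock; apply: IH => z zw; apply: RA.
by rewrite inE zw orbT.
Qed.

Lemma delete_RA_sub A R w : {subset delete_RA A R w <= w}.
Proof.
elim: w => [//|x [|y w] IH] z //.
rewrite [delete_RA _ _ (_ :: _ :: _)]/=.
case: ifP => _; first by rewrite !inE => ->; rewrite !orbT.
by rewrite in_cons => /predU1P[->|/IH zw]; rewrite inE ?eqxx // zw orbT.
Qed.

Lemma delete_RA_size A R w :
  delete_RA A R w = w \/ (size (delete_RA A R w) < size w)%N.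
Proof.
elim: w => [|x [|y w] IH]; try by left.
have -> : delete_RA A R [:: x, y & w] =
   if R x && A y then w else x :: delete_RA A R (y :: w) by [].
case: ifP => _; first by right => /=.
by case: IH => [->|IH]; [left|right; rewrite ltnS].
Qed.

Lemma delete_RA_fix A R w : {in w, forall x, R x = ~~ A x} ->
  delete_RA A R w = w -> w = filter A w ++ filter R w.
Proof.
move=> RA; suff H : forall x w, {in x :: w, forall x, R x = ~~ A x} ->
    delete_RA A R (x :: w) = x :: w -> R x -> all R (x :: w).
  elim: w RA => [//|x w IH] RA E; have Rx := RA x (mem_head _ _).
  have RA' : {in w, forall x, R x = ~~ A x}.
    by move=> z zw; apply: RA; rewrite inE zw orbT.
  case: (boolP (A x)) => Ax; last first.
    have /all_filterP -> : all R (x :: w) by apply: H => //; rewrite Rx.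
    rewrite (eq_in_filter (a2 := pred0)) ?filter_pred0 // => z zw /=.
    apply/negbTE; rewrite -RA //.
    by apply: (allP (H x w RA E _)) => //; rewrite Rx.
  rewrite /= Ax Rx Ax /= -IH //; case: w E {IH H RA RA'} => [//|y w] /=.
  by rewrite Rx Ax /= => -[].
move=> x {RA}{}w; elim: w x => [|y w IH] x RA; first by rewrite /= => _ ->.
have -> : delete_RA A R [:: x, y & w] =
  if R x && A y then w else x :: delete_RA A R (y :: w) by [].
move=> E Rx; move: E; rewrite Rx andTb; case: ifP => [_ E|Ay].
  by have := congr1 size E => /=; lia.
move=> [E]; have RA' : {in y :: w, forall x, R x = ~~ A x}.
  by move=> z zw; apply: RA; rewrite inE zw orbT.
have Ry : R y by rewrite RA' ?mem_head // Ay.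
by apply/andP; split=> //; apply: IH RA' E Ry.
Qed.

Lemma iter_delete_RA_fix A R n w : (size w <= n)%N ->
  delete_RA A R (iter n (delete_RA A R) w) = iter n (delete_RA A R) w.
Proof.
elim: n w => [|n IH] w; first by case: w.
move=> wn; rewrite iterSr; case: (delete_RA_size A R w) => [E|lt].
  by rewrite E; elim: n {IH wn} => [//|n IH] /=; rewrite IH.
by apply: IH; lia.
Qed.

(** The reduced word has the form A^p R^q, and on such a word the machine only
    pushes. *)
Lemma scan_reduced A R w (u := iter (size w) (delete_RA A R) w) :
  {in w, forall x, R x = ~~ A x} ->
  scan A w = (rev (filter A u), rev (filter R u)).
Proof.
move=> RA.
have [uw su] : {subset u <= w} /\ scan A u = scan A w.
  rewrite /u; elim: (size w) => [|n [sub E]]; first by split.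
  split=> /=.
    by move=> z zu; apply: sub; apply: delete_RA_sub zu.
  by rewrite -E /scan delete_RA_scan // => z /sub/RA.
have RAu : {in u, forall x, R x = ~~ A x} by move=> z /uw/RA.
have uE := delete_RA_fix RAu (iter_delete_RA_fix A R (leqnn _)).
rewrite -su [X in scan A X]uE /scan foldl_cat.
have H1 v a : all A v -> foldl (scan_step A) (a, [::]) v = (rev v ++ a, [::]).
  by elim: v a => [//|x v IH] a /= /andP[-> /IH ->]; rewrite rev_cons cat_rcons.
have H2 v a b : all (predC A) v ->
    foldl (scan_step A) (a, b) v = (a, rev v ++ b).
  elim: v b => [//|x v IH] b /= /andP[/negbTE -> /IH ->].
  by rewrite rev_cons cat_rcons.
rewrite H1 ?filter_all // H2 ?cats0 //; apply/allP => z.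
by rewrite mem_filter => /andP[Rz zu] /=; rewrite -RAu.
Qed.

Lemma scan_sub A w x : (x \in (scan A w).1) || (x \in (scan A w).2) -> x \in w.
Proof.
elim/last_ind: w => [//|w y]; rewrite scan_rcons mem_rcons.
case: (scan A w) => a b /= IH; rewrite inE.
case: ifP => _; [case: b IH => [|z b] IH /=|move=> /=]; rewrite ?inE;
  last 1 first.
- by rewrite orbCA => /orP[->//|/IH ->]; rewrite orbT.
- by rewrite orbF => /orP[->//|h]; rewrite IH ?orbT // h.
by move=> h; rewrite IH ?orbT //; case/orP: h => [->//|h]; rewrite inE h !orbT.
Qed.

(** The effect of a crystal operator.  If [k] is the last unmatched A, then no
    A after [k] meets an empty stack of letters R, so turning [k] into an R
    that lies below all others changes no later match; and conversely. *)
Lemma scan_flip A A' w k a b : uniq w -> A k -> ~~ A' k ->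
  {in w, forall x, x != k -> A x = A' x} ->
  scan A w = (k :: a, b) <-> scan A' w = (a, rcons b k).
Proof.
move=> uw Ak nA'k; elim/last_ind: w uw a b => [|w x IH].
  by move=> _ a b _; split=> //; case: b.
rewrite rcons_uniq => /andP[xw uw] a b E; rewrite !scan_rcons.
have Ew : {in w, forall z, z != k -> A z = A' z}.
  by move=> z zw; apply: E; rewrite mem_rcons inE zw orbT.
have {}IH a b := IH uw a b Ew.
have [xk|xk] := eqVneq x k; last first.
  have := E x; rewrite mem_rcons mem_head => /(_ isT xk) Ex.
  split.
    case E1: (scan A w) => [a0 b0] /=; rewrite Ex; case: ifP => A'x; last first.
      by move=> [? ?]; subst a0 b; have /IH -> /= := E1; rewrite A'x.
    case: b0 E1 => [|y b0] E1 [? ?]; first by subst x; rewrite eqxx in xk.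
    by subst a0 b0; have /IH -> /= := E1; rewrite A'x.
  case E1: (scan A' w) => [a0 b0] /=; case: ifP => A'x; last first.
    move=> [?]; subst a0; case: b => [|z b] /=.
      by move=> [? _]; subst x; rewrite eqxx in xk.
    by move=> [? ?]; subst z b0; have /IH -> /= := E1; rewrite Ex A'x.
  case: b0 E1 => [|y b0] E1 [? bE]; first by case: (b) bE.
  by subst a0 b0; have /(IH _ (y :: b)) -> /= := E1; rewrite Ex A'x.
subst x.
have EA : scan A w = scan A' w.
  apply: eq_in_scan => z zw; apply: E; first by rewrite mem_rcons inE zw orbT.
  by apply: contraNneq xw => <-.
rewrite EA; have nk := @scan_sub A' w k.
case: (scan A' w) nk {EA} => a0 b0 /= nk; rewrite Ak (negbTE nA'k); split.
  case: b0 nk => [|y b0] nk [? ?]; first by subst.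
  by subst a0; move: xw; rewrite nk // mem_head.
move=> [? bE]; subst a0; case: b bE => [|z b] /=; first by move=> [->].
by move=> [_ ?]; subst b0; move: xw; rewrite nk // mem_rcons mem_head orbT.
Qed.

(** The difference of the numbers of unmatched letters of both kinds is the
    balance of the word; applied to prefixes, this gives the balance of every
    factor. *)
Lemma scan_size A w : (size (scan A w).1 + count (predC A) w =
  size (scan A w).2 + count A w)%N.
Proof.
elim/last_ind: w => [//|w x]; rewrite scan_rcons -cats1 !count_cat /=.
by case: (scan A w) => a [|y b] /=; case: (A x) => /=; lia.
Qed.

Lemma scan_mono A w1 w2 : exists a', (scan A (w1 ++ w2)).1 =
  a' ++ (scan A w1).1.
Proof.
elim/last_ind: w2 => [|w x [a' IH]]; first by exists [::]; rewrite cats0.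
rewrite -rcons_cat scan_rcons; case: (scan A (w1 ++ w)) IH => a b /= ->.
case: (A x); last by exists a'.
by case: b => [|y b]; [exists (x :: a')|exists a'].
Qed.

(** An A is unmatched when the stack of letters R is empty at its arrival. *)
Lemma scan_unmatchedA A w x : x \in (scan A w).1 -> exists w1 w2 a' a1,
  [/\ w = w1 ++ x :: w2, A x, scan A w1 = (a1, [::]) &
      (scan A w).1 = a' ++ x :: a1].
Proof.
elim/last_ind: w => [//|w z IH]; rewrite scan_rcons.
have old : x \in (scan A w).1 -> (scan A w).1 = (scan_step A (scan A w) z).1 ->
  exists w1 w2 a' a1, [/\ rcons w z = w1 ++ x :: w2, A x, scan A w1 = (a1, [::])
    & (scan_step A (scan A w) z).1 = a' ++ x :: a1].
  move=> /IH[w1 [w2 [a' [a1 [-> Ax E1 ->]]]]] <-.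
  by exists w1, (rcons w2 z), a', a1; rewrite rcons_cat.
case Ew: (scan A w) IH old => [a b] /= IH; case: ifP => Az;
  last by move=> h /h; apply.
case: b Ew IH => [|y b] Ew IH; last by move=> h /h; apply.
move=> _; rewrite /= inE => /predU1P[->|/IH].
  by exists w, [::], [::], a; rewrite cats1.
move=> [w1 [w2 [a' [a1 [-> Ax E1 ->]]]]].
by exists w1, (rcons w2 z), (z :: a'), a1; rewrite rcons_cat.
Qed.

(** From the arrival of an unmatched R on, the stack of letters R is never
    empty, so that no new A remains unmatched; this is recorded for
    every prefix [u] of the rest of the word. *)
Lemma scan_unmatchedR A w x : uniq w -> x \in (scan A w).2 ->
  exists w1 w2 b' b1,
  [/\ w = w1 ++ x :: w2, ~~ A x, scan A w1 = ((scan A w).1, b1),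
      (scan A w).2 = b' ++ x :: b1 &
      forall u v, w2 = u ++ v -> (size b1 < size (scan A (w1 ++ x :: u)).2)%N
                   /\ (scan A (w1 ++ x :: u)).1 = (scan A w).1].
Proof.
elim/last_ind: w => [//|w z IH]; rewrite rcons_uniq => /andP[zw uw].
rewrite scan_rcons => xb.
have [xz|xz] := eqVneq x z.
  subst z; have := @scan_sub A w x; rewrite (negbTE zw).
  case Ew: (scan A w) xb => [a b] /=; case: ifP => Ax /=.
    by case: b Ew => [|y b] Ew //= xb h; have := h;
      rewrite inE xb !orbT => /(_ isT).
  move=> _ _; exists w, [::], [::], b; split=> //; rewrite ?cats1 //.
  case=> [|//] v _; rewrite cats1 scan_rcons Ew /= Ax /=; split=> //.
have xb' : x \in (scan A w).2.
  move: xb; case: (scan A w) => a b /=; case: ifP => _ /=.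
    by case: b => [|y b] //= h; rewrite inE h orbT.
  by rewrite inE (negbTE xz).
have [w1 [w2 [b' [b1 [Ew nAx E1 E2 H]]]]] := IH uw xb'.
have E3 : (scan_step A (scan A w) z).1 = (scan A w).1.
  by case: (scan A w) xb' => a [|y b] //= _; case: (A z).
have [b2 E4] : exists b2, (scan_step A (scan A w) z).2 = b2 ++ x :: b1.
  case Es: (scan A w) xb xb' E2 => [a b] /= xb xb' E2; subst b.
  move: xb; case: (A z) => /=; last by exists (z :: b').
  case: b' {xb'} Es => [|y b'] Es /=; last by exists b'.
  move=> xb1; have := @scan_sub A w1 x; rewrite E1 /= xb1 orbT => /(_ isT) xw1.
  by move: uw; rewrite Ew cat_uniq /= xw1 /= andbF.
exists w1, (rcons w2 z), b2, b1; rewrite E3; split=> //.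
  by rewrite Ew rcons_cat.
move=> u v; case/lastP: v => [|v t].
  rewrite cats0 => <-; rewrite -rcons_cons -rcons_cat -Ew scan_rcons E3 E4.
  by rewrite size_cat /=; split=> //; lia.
by rewrite -rcons_cat => /rcons_inj[/H h _].
Qed.

End Scan.

Lemma scan_uniq (T : eqType) (A : pred T) w :
  uniq w -> uniq (scan A w).1 /\ uniq (scan A w).2.
Proof.
elim/last_ind: w => [//|w x IH]; rewrite rcons_uniq scan_rcons.
move=> /andP[xw /IH]; have := @scan_sub _ A w x.
case: (scan A w) => a b /= sub [ua ub]; case: (A x).
  case: b sub ub => [|y b] sub ub /=; last by case/andP: ub.
  by rewrite ua andbT; split=> //; apply: contraNN xw => h; rewrite sub ?h.
by rewrite /= ub andbT; split=> //; apply: contraNN xw => h;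
  rewrite sub ?h ?orbT.
Qed.

Lemma scan_map (T T' : eqType) (f : T -> T') (A : pred T') w :
  scan A (map f w) = (map f (scan (preim f A) w).1,
    map f (scan (preim f A) w).2).
Proof.
elim/last_ind: w => [//|w x IH]; rewrite map_rcons !scan_rcons IH.
case: (scan _ w) => a [|y b] /=; by case: (A (f x)).
Qed.

(** * Cyclic intervals and the greedy choice *)

(** The interval from [j] to [x] on the line closed up to a circle: if [x < j]
    it goes through infinity. *)
Definition cyc_itv (j x z : int) : bool :=
  if j <= x then j <= z <= x else (j <= z) || (z <= x).

Lemma cyc_start j x : cyc_itv j x j.
Proof. by rewrite /cyc_itv; case: ifP; lia. Qed.

Lemma cyc_end j x : cyc_itv j x x.
Proof. by rewrite /cyc_itv; case: ifP; lia. Qed.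

Lemma cyc_trans y x0 x j : ~~ cyc_itv y x0 x -> cyc_itv j x y -> cyc_itv j x x0.
Proof. by rewrite /cyc_itv; do !case: ifP; lia. Qed.

Lemma cyc_between y x0 x : ~~ cyc_itv y x0 x -> cyc_itv y x x0.
Proof. by rewrite /cyc_itv; do !case: ifP; lia. Qed.

Lemma cyc_extend y x0 x j z : ~~ cyc_itv y x0 x ->
  cyc_itv j x x0 -> ~~ cyc_itv j x y ->
  ~~ cyc_itv y x0 z -> cyc_itv y x z = cyc_itv j x z.
Proof. by rewrite /cyc_itv; do !case: ifP; lia. Qed.

Lemma cyc_sub y x0 x j z : ~~ cyc_itv y x0 x ->
  cyc_itv j x x0 -> ~~ cyc_itv j x y ->
  cyc_itv j x z -> cyc_itv y x z.
Proof. by rewrite /cyc_itv; do !case: ifP; lia. Qed.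

(** For an increasing [U], the first element met when going up from [y] on the
    circle. *)
Definition next_entry (U : seq int) (y : int) :=
  head (head 0 U) [seq x <- U | y <= x].

Lemma next_entryP U y : sorted <%R U -> U != [::] ->
  next_entry U y \in U /\ {in U, forall z, cyc_itv y (next_entry U y) z -> z =
    next_entry U y}.
Proof.
move=> sU U0; rewrite /next_entry.
have hP (s : seq int) d : sorted <%R s -> s != [::] ->
    head d s \in s /\ {in s, forall z, head d s <= z}.
  case: s => [//|h s] /= ss _; split; first exact: mem_head.
  move=> z; rewrite inE => /predU1P[->//|zs].
  by have /allP/(_ z zs)/ltW := order_path_min lt_trans ss.
have [E|ne] := eqVneq [seq x <- U | y <= x] [::].
  have [hU hmin] := hP U 0 sU U0; rewrite E /=; split=> // z zU.
  have lt t : t \in U -> t < y.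
    move=> tU; rewrite ltNge; apply/negP => yt.
    by have : t \in [seq x <- U | y <= x] by [rewrite mem_filter yt]; rewrite E.
  have := lt _ hU; have := lt _ zU; have := hmin _ zU; rewrite /cyc_itv.
  by case: ifP; lia.
have sF : sorted <%R [seq x <- U | y <= x] := sorted_filter lt_trans _ sU.
have [] := hP _ (head 0 U) sF ne; set h := head _ _.
rewrite mem_filter => /andP[yh hU] hmin; split=> // z zU.
rewrite /cyc_itv yh => /andP[yz zh]; apply/eqP; rewrite eq_le zh.
by apply: hmin; rewrite mem_filter yz.
Qed.

Lemma rem_sorted (U : seq int) x : sorted <%R U -> sorted <%R (rem x U).
Proof. by apply: subseq_sorted (rem_subseq _ _); exact: lt_trans. Qed.

Lemma choose_up_sub U V : sorted <%R U -> (size V <= size U)%N ->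
  [/\ {subset choose_up U V <= U}, uniq (choose_up U V) &
      size (choose_up U V) = size V].
Proof.
elim: V U => [//|y V IH] U sU /= sz.
have U0 : U != [::] by case: U sz {sU}.
have [xU _] := next_entryP y sU U0; rewrite -/(next_entry U y);
  set x := next_entry U y in xU *.
have [|sub un sE] := IH (rem x U) (rem_sorted x sU).
  by rewrite size_rem // -ltnS (leq_trans sz) // leqSpred.
have uU : uniq U := sorted_uniq lt_trans ltxx sU.
split; last by rewrite sE.
  by move=> z; rewrite inE => /predU1P[->//|/sub/mem_rem].
by rewrite un andbT; apply/negP => /sub; rewrite mem_rem_uniq // inE eqxx.
Qed.

(** Let [x0] be the element given to [y], the next one of [U] on the circle.
    An interval ending at an element of [U] that contains [y] contains [x0].
    If it contains [x0] but not [y], extending it back to [y] adds no element of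
    [U].  Hence removing [y] and [x0] preserves the criterion for the other
    elements of [U], while [x0] violates it on the interval from [y] to [x0]. *)
Lemma choose_upP U V x : sorted <%R U -> uniq V -> (size V <= size U)%N ->
  x \in U -> (x \notin choose_up U V) <->
  (forall j, (count (cyc_itv j x) V < count (cyc_itv j x) U)%N).
Proof.
elim: V U => [|y V IH] U sU.
  move=> _ _ xU; split=> // _ j; rewrite -has_count; apply/hasP; exists x => //.
  by rewrite /cyc_itv; case: ifP => //; lia.
move=> /= /andP[yV uV] sz xU.
have U0 : U != [::] by case: U sz {sU xU}.
have [x0U gap] := next_entryP y sU U0.
rewrite -/(next_entry U y) inE negb_or; set x0 := next_entry U y in x0U gap *.
clearbody x0.
have uU : uniq U := sorted_uniq lt_trans ltxx sU.
have cntU p : count p U = (p x0 + count p (rem x0 U))%N.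
  by rewrite (seq.permP (perm_to_rem x0U)).
have [xx0|xx0] := eqVneq x x0.
  split=> // /(_ y); rewrite -xx0 /= cyc_start.
  have -> : count (cyc_itv y x) U = 1%N.
    rewrite cntU -xx0 cyc_end.
    rewrite (eq_in_count (a2 := pred0)) ?count_pred0 // => z.
    rewrite mem_rem_uniq // => /andP[zx zU]; apply/negbTE/negP => h.
    by move: zx; rewrite /= (gap z zU) -?xx0 ?eqxx.
  by rewrite add1n ltnS ltn0.
have nxt : ~~ cyc_itv y x0 x by apply: contra xx0 => /(gap _ xU) ->.
have xU' : x \in rem x0 U by rewrite mem_rem_uniq // inE xx0.
have IH' := IH (rem x0 U) (rem_sorted x0 sU) uV.
rewrite size_rem // in IH'; have {IH} IH' := IH' _ xU'.
rewrite /= IH'; last by rewrite -ltnS (leq_trans sz) // leqSpred.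
split=> H j.
  have := H j; rewrite cntU; have := cyc_trans (j := j) nxt.
  case: (cyc_itv j x y) => [/(_ isT) -> h|_ h]; first by rewrite ltn_add2l.
  rewrite [nat_of_bool false]/= add0n.
  by rewrite (leq_trans h) // leq_addl.
have := H j; rewrite cntU.
(* If [x0] is in the interval and [y] is not, extend the interval back to [y].
*)
case xI: (cyc_itv j x x0); case yI: (cyc_itv j x y); rewrite ?ltn_add2l //;
  last first.
  by rewrite (cyc_trans nxt yI) in xI.
move=> _; have := H y; rewrite cntU cyc_start (cyc_between nxt) ltn_add2l.
have yI' := negbT yI.
have -> : count (cyc_itv y x) (rem x0 U) = count (cyc_itv j x) (rem x0 U).
  apply: eq_in_count => z; rewrite mem_rem_uniq // => /andP[zx zU].
  by apply: cyc_extend nxt xI yI' _; apply: contra zx => /(gap _ zU) ->.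
by apply: leq_ltn_trans; apply: sub_count => z; apply: cyc_sub nxt xI yI'.
Qed.

(** The list [map -%R U] is decreasing: [choose_upP] is used for an arbitrary
    order of its second argument. *)
Lemma choose_down_opp V U : uniq V ->
  choose_down V U = map -%R (choose_up (rev (map -%R V)) (map -%R U)).
Proof.
elim: U V => [//|x U IH] V uV; rewrite (lock rev) /= -lock.
have hr d (s : seq int) : last d s = head d (rev s).
  by case/lastP: s => [//|s z]; rewrite last_rcons rev_rcons.
have hm (d : int) s : head (- d) (map -%R s) = - head d s by case: s.
have E : next_entry (rev (map -%R V)) (- x) =
         - last (last 0 V) [seq y <- V | y <= x].
  rewrite /next_entry !hr -!hm filter_rev !map_rev oppr0.
  congr (head _ (rev _)); rewrite filter_map; congr (map _ _).
  by apply: eq_filter => z /=; lia.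
rewrite -/(next_entry _ _) E opprK; congr (_ :: _).
rewrite IH ?rem_uniq //; congr (map _ (choose_up _ _)).
rewrite !rem_filter ?rev_uniq ?(map_inj_uniq oppr_inj) // filter_rev filter_map.
by congr (rev (map _ _)); apply: eq_filter => z /=; rewrite eqr_opp.
Qed.

Lemma choose_down_sub V U : sorted <%R V -> (size U <= size V)%N ->
  [/\ {subset choose_down V U <= V}, uniq (choose_down V U) &
      size (choose_down V U) = size U].
Proof.
move=> sV sz; have uV : uniq V := sorted_uniq lt_trans ltxx sV.
have sV' : sorted <%R (rev (map -%R V)).
  by rewrite rev_sorted sorted_map; apply: sub_sorted sV => y z /=; lia.
rewrite choose_down_opp // size_map (map_inj_uniq oppr_inj).
have [|sub -> ->] := @choose_up_sub _ (map -%R U) sV'.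
  by rewrite size_rev !size_map.
rewrite size_map; split=> // z /mapP[t /sub].
by rewrite mem_rev => /mapP[y yV ->] ->; rewrite opprK.
Qed.

Lemma choose_downP V U x : sorted <%R V -> uniq U -> (size U <= size V)%N ->
  x \in V -> (x \notin choose_down V U) <->
  (forall j, (count (cyc_itv x j) U < count (cyc_itv x j) V)%N).
Proof.
move=> sV uU sz xV; have uV : uniq V := sorted_uniq lt_trans ltxx sV.
have sV' : sorted <%R (rev (map -%R V)).
  by rewrite rev_sorted sorted_map; apply: sub_sorted sV => y z /=; lia.
rewrite choose_down_opp // -{1}(opprK x) (mem_map oppr_inj).
rewrite choose_upP //; last 3 first.
- by rewrite (map_inj_uniq oppr_inj).
- by rewrite size_rev !size_map.
- by rewrite mem_rev (mem_map oppr_inj).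
have cE j : preim -%R (cyc_itv j (- x)) =1 cyc_itv x (- j).
  by move=> z /=; rewrite /cyc_itv; do !case: ifP; lia.
have cntE j : (count (cyc_itv j (- x)) (map -%R U) <
   count (cyc_itv j (- x)) (rev (map -%R V)))%N =
   (count (cyc_itv x (- j)) U < count (cyc_itv x (- j)) V)%N.
  by rewrite count_rev !count_map !(eq_count (cE j)).
by split=> H j; have := H (- j); rewrite cntE ?opprK.
Qed.

(** * The greedy choice leaves unmatched letters *)

Lemma sorted_split (s : seq int) (j : int) : sorted <%R s ->
  exists u v, [/\ s = u ++ v, {in u, forall z, z < j} & {in v, forall z,
    j <= z}].
Proof.
move=> ss; exists [seq z <- s | z < j], [seq z <- s | j <= z]; split;
  last 2 first.
- by move=> z; rewrite mem_filter => /andP[].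
- by move=> z; rewrite mem_filter => /andP[].
elim: s ss => [//|z s IH] /= ss; have /IH E := path_sorted ss.
have /allP zs := order_path_min lt_trans ss.
case: ltP => [zj|jz] /=; first by rewrite -E.
rewrite (eq_in_filter (a2 := pred0)) ?filter_pred0 /=; last first.
  by move=> t ts /=; have := zs t ts; lia.
congr (_ :: _); apply/esym/all_filterP/allP => t ts; have := zs t ts; lia.
Qed.

Lemma filter_all_id (T : eqType) (p : pred T) s : {in s, forall z, p z} ->
  filter p s = s.
Proof. by move=> h; apply/all_filterP/allP. Qed.

Lemma filter_none (T : eqType) (p : pred T) s : {in s, forall z, p z = false} ->
  filter p s = [::].
Proof. by move=> h; rewrite (eq_in_filter (a2 := pred0)) ?filter_pred0. Qed.

Lemma cyc_itv_le j x z : j <= x -> cyc_itv j x z = (j <= z <= x).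
Proof. by rewrite /cyc_itv => ->. Qed.

Lemma cyc_itv_gt j x z : x < j -> cyc_itv j x z = (j <= z) || (z <= x).
Proof. by rewrite /cyc_itv ltNge => /negbTE ->. Qed.

Lemma filter_cyc_itv_le u m v j x : j <= x -> {in u, forall z, z < j} ->
  {in m, forall z, j <= z <= x} -> {in v, forall z, x < z} ->
  filter (cyc_itv j x) (u ++ m ++ v) = m.
Proof.
move=> jx hu hm hv; rewrite !filter_cat (filter_none (s := u)).
  rewrite filter_all_id => [|z zm]; last by rewrite cyc_itv_le // hm.
  rewrite (filter_none (s := v)) ?cats0 // => z /hv xz.
  by rewrite cyc_itv_le // (leNgt z) xz andbF.
by move=> z /hu zj; rewrite cyc_itv_le // leNgt zj.
Qed.

Lemma filter_cyc_itv_gt u m v j x : x < j -> {in u, forall z, z <= x} ->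
  {in m, forall z, x < z < j} -> {in v, forall z, j <= z} ->
  filter (cyc_itv j x) (u ++ m ++ v) = u ++ v.
Proof.
move=> jx hu hm hv; rewrite !filter_cat (filter_none (s := m)).
  rewrite filter_all_id => [|z zm]; last by rewrite cyc_itv_gt // hu ?orbT.
  by rewrite filter_all_id // => z /hv zj; rewrite cyc_itv_gt // zj.
by move=> z /hm/andP[xz zj]; rewrite cyc_itv_gt // !leNgt zj xz.
Qed.

Lemma index_mid (T : eqType) (s1 s2 : seq T) x :
  uniq (s1 ++ x :: s2) -> index x (s1 ++ x :: s2) = size s1.
Proof.
rewrite cat_uniq /= index_cat => /and3P[_ /norP[/negbTE -> _] _].
by rewrite /= eqxx addn0.
Qed.

Lemma mem_take_mid (T : eqType) (s1 s2 : seq T) x n :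
  uniq (s1 ++ x :: s2) -> x \in take n (s1 ++ x :: s2) -> (size s1 < n)%N.
Proof. by move=> u xt; rewrite -(index_mid u) -in_take // (mem_take xt). Qed.

Lemma mem_drop_mid (T : eqType) (s1 s2 : seq T) x n :
  uniq (s1 ++ x :: s2) -> x \in drop n (s1 ++ x :: s2) -> (n <= size s1)%N.
Proof.
move=> u xd; rewrite -(index_mid u) leqNgt -in_take ?(mem_drop xd) //.
move: u; rewrite -{1}(cat_take_drop n (s1 ++ _)) cat_uniq => /and3P[_ h _].
exact: (hasPn h).
Qed.

Lemma size_filter_notin (T : eqType) (s c : seq T) :
  uniq s -> uniq c -> {subset c <= s} ->
  size [seq z <- s | z \notin c] = (size s - size c)%N.
Proof.
move=> us uc sub.
suff /perm_size -> : perm_eq s (c ++ [seq z <- s | z \notin c]).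
  by rewrite size_cat addKn.
apply: uniq_perm => // [|z].
  rewrite cat_uniq uc filter_uniq // andbT /=; apply/hasPn => z.
  by rewrite mem_filter => /andP[].
by rewrite mem_cat mem_filter; case: (boolP (z \in c)) => // /sub.
Qed.

Section Choose.
Variables U V W : seq int.
Hypotheses (sU : sorted <%R U) (sV : sorted <%R V) (sW : sorted <%R W).
Hypothesis WE : forall k, (k \in W) = ((k \in U) != (k \in V)).

Let uU : uniq U. Proof. exact: sorted_uniq lt_trans ltxx _ sU. Qed.
Let uV : uniq V. Proof. exact: sorted_uniq lt_trans ltxx _ sV. Qed.
Let uW : uniq W. Proof. exact: sorted_uniq lt_trans ltxx _ sW. Qed.

(** Common entries contribute equally to both sides, so only the letters of the
    word matter for the balance of an interval. *)
Lemma count_symdiff p :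
  (count p U + count (predC (mem U)) (filter p W) =
   count p V + count (mem U) (filter p W))%N.
Proof.
have swap q : count q (filter p W) = count p (filter q W).
  by rewrite !count_filter; apply: eq_count => z /=; rewrite andbC.
rewrite !swap.
have E1 : perm_eq U (filter (mem V) U ++ filter (mem U) W).
  apply: uniq_perm => //.
    rewrite cat_uniq !filter_uniq // andbT /=; apply/hasPn => z.
    by rewrite !mem_filter WE /=; case: (z \in U); case: (z \in V).
  move=> z; rewrite mem_cat !mem_filter WE /=.
  by case: (z \in U); case: (z \in V).
have E2 : perm_eq V (filter (mem V) U ++ filter (predC (mem U)) W).
  apply: uniq_perm => //.
    rewrite cat_uniq !filter_uniq // andbT /=; apply/hasPn => z.
    by rewrite !mem_filter WE /=; case: (z \in U); case: (z \in V).
  move=> z; rewrite mem_cat !mem_filter WE /=.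
  by case: (z \in U); case: (z \in V).
rewrite (seq.permP E1 p) (seq.permP E2 p) !count_cat; exact: addnAC.
Qed.

Lemma size_symdiff :
  (size U + size (scan (mem U) W).2 = size V + size (scan (mem U) W).1)%N.
Proof.
have := count_symdiff predT; have := scan_size (mem U) W.
rewrite !count_predT filter_predT; clear; lia.
Qed.

Lemma sorted_parts w1 x w2 : W = w1 ++ x :: w2 ->
  [/\ sorted <%R w1, sorted <%R w2, {in w1, forall z, z < x} &
      {in w2, forall z, x < z}].
Proof.
move=> E; have := sW; rewrite E (sorted_pairwise lt_trans) pairwise_cat /=.
case/and3P=> /allrelP h p1 /andP[/allP h2 p2].
rewrite !(sorted_pairwise lt_trans); split=> // z zw.
by apply: h => //; apply: mem_head.
Qed.

(** It suffices to show that the letters on the right-hand side satisfy the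
    criterion of [choose_upP], because there are as many of them as entries left
    over.  Let q be the number of unmatched letters R.  A linear interval ending
    at an unmatched A has positive balance.  For an interval through infinity,
    the upper part has balance at least - q, and the lower part has
    balance the rank of [x] among the unmatched letters A, which exceeds q for
    the letters in question. *)
Lemma choose_up_scan x : (size V <= size U)%N -> x \in U ->
  (x \notin choose_up U V) = (x \in take (size U - size V) (scan (mem U) W).1).
Proof.
move=> sz xU; have [Csub Cu Csz] := choose_up_sub sU sz.
have szE := size_symdiff.
have H : {subset take (size U - size V) (scan (mem U) W).1 <=
          [seq z <- U | z \notin choose_up U V]}.
  move=> {xU}x xt; have xa := mem_take xt.
  have [w1 [w2 [a' [a1 [EW xU E1 E2]]]]] := scan_unmatchedA xa.
  have xU' : x \in U by [].
  rewrite mem_filter xU' andbT; apply/(choose_upP sU uV sz xU') => j.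
  have [s1 s2 h1 h2] := sorted_parts EW.
  have := count_symdiff (cyc_itv j x); case: (leP j x) => jx.
    have [u [v [Ew1 hu hv]]] := sorted_split j s1.
    have -> : filter (cyc_itv j x) W = v ++ [:: x].
      rewrite EW Ew1 -catA -(cat1s x) (catA v);
        apply: filter_cyc_itv_le => // z.
      rewrite mem_cat inE => /orP[zv|/eqP->]; last by rewrite jx lexx.
      by rewrite hv //= ltW // h1 // Ew1 mem_cat zv orbT.
    have := scan_size (mem U) w1; have := scan_size (mem U) u.
    (* The unmatched letters A before [j] stay unmatched up to [x]. *)
    have [a2] := scan_mono (mem U) u v; rewrite -Ew1 E1 /=.
    move=> /(congr1 size); rewrite Ew1 !count_cat size_cat /= xU' /=; clear;
      lia.
  have [u [v [Ew2 hu hv]]] := sorted_split j s2.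
  have EW' : W = (w1 ++ x :: u) ++ v by rewrite EW Ew2 -catA.
  have -> : filter (cyc_itv j x) W = (w1 ++ [:: x]) ++ v.
    rewrite EW Ew2 -(cat1s x) catA; apply: filter_cyc_itv_gt => // z zz.
      move: zz; rewrite mem_cat inE => /orP[/h1/ltW //|/eqP->]; exact: lexx.
    by rewrite hu // h2 // Ew2 mem_cat zz.
  have := scan_size (mem U) w1; have := scan_size (mem U) (w1 ++ x :: u).
  have := scan_size (mem U) W.
  have [a2] := scan_mono (mem U) (w1 ++ x :: u) v; rewrite -EW'.
  have cW q : count q W = (count q w1 + (q x + (count q u + count q v)))%N.
    by rewrite EW Ew2 count_cat /= count_cat.
  move=> /(congr1 size); rewrite E1 !cW !count_cat size_cat /= xU' /=.
  have : (size a' < size U - size V)%N.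
    have ux : uniq (a' ++ x :: a1) by rewrite -E2;
      have [] := scan_uniq (mem U) uW.
    by move: xt; rewrite E2; apply: mem_take_mid.
  move: szE; rewrite E2 size_cat /=; clear; lia.
have sF := size_filter_notin uU Cu Csub; rewrite Csz in sF.
have [||_ ->] := uniq_min_size _ H; last by rewrite mem_filter xU andbT.
  by rewrite take_uniq //; have [] := scan_uniq (mem U) uW.
by rewrite sF size_takel //; lia.
Qed.

(** The mirror argument, with intervals starting at [x].  The dropped prefix
    has as many elements as there are unmatched letters A. *)
Lemma choose_down_scan x : (size U <= size V)%N -> x \in V ->
  (x \notin choose_down V U) =
  (x \in drop (size U + size (scan (mem U) W).2 - size V) (scan (mem U) W).2).
Proof.
move=> sz xV; have [Csub Cu Csz] := choose_down_sub sV sz.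
have szE := size_symdiff.
set t := (size U + size (scan (mem U) W).2 - size V)%N.
have tE : t = size (scan (mem U) W).1 by rewrite /t szE addKn.
have H : {subset drop t (scan (mem U) W).2 <=
          [seq z <- V | z \notin choose_down V U]}.
  move=> {xV}x xt; have xa := mem_drop xt.
  have [w1 [w2 [b' [b1 [EW xU E1 E2 hyp]]]]] := scan_unmatchedR uW xa.
  have /negbTE xU' : x \notin U by [].
  have xV : x \in V by have := WE x; rewrite EW mem_cat mem_head orbT xU' /=;
    case: (x \in V).
  rewrite mem_filter xV andbT; apply/(choose_downP sV uU sz xV) => j.
  have [s1 s2 h1 h2] := sorted_parts EW.
  have tb : (t <= size b')%N.
    have ux : uniq (b' ++ x :: b1) by rewrite -E2;
      have [] := scan_uniq (mem U) uW.
    by move: xt; rewrite E2; apply: mem_drop_mid.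
  have := count_symdiff (cyc_itv x j); case: (leP x j) => jx.
    have [u [v [Ew2 hu hv]]] := sorted_split (j + 1) s2.
    have -> : filter (cyc_itv x j) W = x :: u.
      rewrite EW Ew2 -cat_cons; apply: filter_cyc_itv_le => // z zz; last first.
        by rewrite -lezD1 hv.
      move: zz; rewrite inE => /predU1P[->|zu]; first by rewrite lexx.
      by rewrite ltW /= ?h2 ?Ew2 ?mem_cat ?zu // -ltzD1 hu.
    have := scan_size (mem U) w1; have := scan_size (mem U) (w1 ++ x :: u).
    have [] := hyp _ _ Ew2; rewrite E1 => h -> /=.
    move: h; rewrite !count_cat /= xU' /=; clear; lia.
  have [u [v [Ew1 hu hv]]] := sorted_split (j + 1) s1.
  have EW' : W = u ++ (v ++ x :: w2) by rewrite EW Ew1 -catA.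
  have -> : filter (cyc_itv x j) W = u ++ x :: w2.
    rewrite EW'; apply: filter_cyc_itv_gt => // z zz.
    - by rewrite -ltzD1 hu.
    - by rewrite h1 ?Ew1 ?mem_cat ?zz ?orbT // andbT -lezD1 hv.
    by move: zz; rewrite inE => /predU1P[->|/h2/ltW //]; exact: lexx.
  have := scan_size (mem U) w1; have := scan_size (mem U) u.
  have := scan_size (mem U) W.
  have [a2] := scan_mono (mem U) u v; rewrite -Ew1.
  have cW q : count q W = (count q u + (count q v + (q x + count q w2)))%N.
    by rewrite EW' !count_cat.
  move=> /(congr1 size); rewrite E1 E2 !cW Ew1 !count_cat !size_cat /= xU' /=.
  move: szE tb; rewrite tE E2 size_cat /=; clear; lia.
have sF := size_filter_notin uV Cu Csub; rewrite Csz in sF.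
have [||_ ->] := uniq_min_size _ H; last by rewrite mem_filter xV andbT.
  by rewrite drop_uniq //; have [] := scan_uniq (mem U) uW.
by rewrite sF size_drop tE -[leqRHS](subnDl (size U)) szE subnDr.
Qed.

End Choose.

(** * Adding and removing one node *)

Lemma intpart_of_fun (f : nat -> nat) (K : nat) :
  (forall k, (1 <= k)%N -> (f k.+1 <= f k)%N) ->
  (forall k, (K < k)%N -> f k = 0%N) ->
  exists mu : intpart, forall k, (1 <= k)%N -> part mu k = f k.
Proof.
move=> dec f0; have [|mu muE] := @intpart_of_seq (mkseq (fun k => f k.+1) K).
  apply/(sortedP 0%N) => k; rewrite size_mkseq => h.
  have kK := ltnW h; rewrite !nth_mkseq //; exact: dec.
exists mu; case=> // k _; rewrite muE; case: (ltnP k K) => h.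
  by rewrite nth_mkseq.
by rewrite nth_default ?size_mkseq // f0.
Qed.

Definition set_component (l : nat) (lam : rpart l) (c : 'I_l) (p : intpart) :
    rpart l :=
  [ffun c' => if c' == c then p else lam c'].

Lemma addableP (l : nat) (lam : rpart l) (a b : nat) (c : 'I_l) :
  addable lam (a, b, c) <->
  [/\ (1 <= a)%N, b = (part (lam c) a).+1 &
      (1 < a)%N -> (b <= part (lam c) a.-1)%N].
Proof.
split; first exact: addable_bounds.
move=> [a1 bE h]; split; first by move=> [_ _]; lia.
have [||p pE] := @intpart_of_fun (fun k =>
  part (lam c) k + (k == a))%N (size (lam c) + a).
- move=> k k1; have := part_le (lam c) (leqnSn k).
  have [ka|_] := eqVneq k.+1 a; last by lia.
  by subst a; move: h => /=; lia.
- move=> k k1; have : part (lam c) k == 0%N by rewrite part_eq0; lia.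
  by lia.
exists (set_component lam c p); apply/seteqP; split=> -[[a' b'] c'] /=;
  rewrite ffunE.
  move=> [a'1 b'1]; case: eqP => [->|_]; last by right.
  rewrite pE //; case: (eqVneq a' a) => [->|_] b'E; last by right; split=> //;
    lia.
  by have [->|bb] := eqVneq b' b; [left|right; split=> //; lia].
case=> [[-> -> ->]|[a'1 b'1 b'E]]; first by rewrite eqxx pE // eqxx;
  split=> //; lia.
by split=> //; case: eqP => // cc; rewrite pE //; subst c'; lia.
Qed.

Lemma removableP (l : nat) (lam : rpart l) (a b : nat) (c : 'I_l) :
  removable lam (a, b, c) <->
  [/\ (1 <= a)%N, (1 <= b)%N, b = part (lam c) a &
      (part (lam c) a.+1 < b)%N].
Proof.
split; first exact: removable_bounds.
move=> [a1 b1 bE h]; split; first by split=> //; lia.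
have [||p pE] := @intpart_of_fun (fun k =>
  part (lam c) k - (k == a))%N (size (lam c)).
- move=> k k1; have := part_le (lam c) (leqnSn k).
  by have [ka|_] := eqVneq k a; [subst k|]; lia.
- move=> k k1; have : part (lam c) k == 0%N by rewrite part_eq0; lia.
  by lia.
exists (set_component lam c p); apply/seteqP; split=> -[[a' b'] c'] /=;
  rewrite ffunE.
  move=> [a'1 b'1]; case: eqP => [->|cc]; last by split=> // -[].
  rewrite pE // => b'E; split; first by split=> //; lia.
  by move=> [aa bb]; move: b'E; rewrite aa eqxx; lia.
case=> [[a'1 b'1 b'E] ne]; split=> //; case: eqP => // cc; subst c'.
rewrite pE //; have [aa|_] := eqVneq a' a; last by rewrite subn0.
subst a'; have bb : b' <> b by move=> bb; apply: ne; rewrite bb.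
by rewrite subn1; lia.
Qed.

Lemma add_node_part (l : nat) (lam : rpart l) (a b : nat) (c c' : 'I_l) k :
  addable lam (a, b, c) -> (1 <= k)%N ->
  part (add_node lam (a, b, c) c') k =
  (part (lam c') k + ((k == a) && (c' == c)))%N.
Proof.
move=> gadd k1; have [a1 bE _] := addable_bounds gadd.
have H b' : (1 <= b')%N -> (b' <= part (add_node lam (a, b, c) c') k)%N <->
    (k, b', c') = (a, b, c) \/ (b' <= part (lam c') k)%N.
  move=> b1; have := add_nodeP gadd => /(congr1 (fun S => S (k, b', c'))) /= E.
  split=> [h|h].
    have : [/\ (1 <= k)%N, (1 <= b')%N & (b' <= part (add_node lam (a, b,
      c) c') k)%N] by [].
    by rewrite E => -[->|[]]; [left|right].
  suff : [/\ (1 <= k)%N, (1 <= b')%N & (b' <= part (add_node lam (a, b,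
    c) c') k)%N] by case.
  by rewrite E; case: h => [->|h]; [left|right].
have H1 := H (part (add_node lam (a, b, c) c') k).
have H2 := H (part (lam c') k).
have H3 := H (part (lam c') k).+1.
have [E|nE] /= := eqVneq (k, c') (a, c).
  case: E => ? ?; subst k c'; rewrite !eqxx /=.
  have [_ /(_ (or_introl _ _))] := H b ltac:(lia) => /(_ erefl).
  move: H1; set x := part (add_node _ _ _) _; clearbody x.
  move=> H1 bx; case: (posnP x) => x0; first by lia.
  by have [/(_ (leqnn _))] := H1 x0; case=> [[]|]; lia.
have -> : (k == a) && (c' == c) = false.
  by apply/negbTE; apply: contraNN nE => /andP[/eqP-> /eqP->].
rewrite addn0; apply/eqP; rewrite eqn_leq; apply/andP; split.
  case: posnP H1 => [->//|x0] /(_ isT) [/(_ (leqnn _))] [[ka _ cc]|//].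
  by move: nE; rewrite ka cc eqxx.
case: posnP H2 => [->//|x0] /(_ isT) [_]; apply; by right.
Qed.

(** Together with [remove_add_node] this makes the removal of a node the inverse
    of an addition, so that only additions have to be studied. *)
Lemma add_remove_node (l : nat) (lam : rpart l) g : addable lam g ->
  removable (add_node lam g) g /\ remove_node (add_node lam g) g = lam.
Proof.
move=> ga; have E := add_nodeP ga; case: (ga) => ng _.
have Er : diagram (add_node lam g) `\ g = diagram lam.
  rewrite E; apply/seteqP; split=> h; first by case=> -[].
  by move=> dh; split; [right|move=> /= hg; apply: ng; rewrite -hg].
have gr : removable (add_node lam g) g.
  by split; [rewrite E; left|exists lam].
by split=> //; apply: diagram_inj; rewrite remove_nodeP.
Qed.

Lemma remove_add_node (l : nat) (lam : rpart l) g : removable lam g ->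
  addable (remove_node lam g) g /\ add_node (remove_node lam g) g = lam.
Proof.
move=> gr; have E := remove_nodeP gr; case: (gr) => dg _.
have Ea : g |` diagram (remove_node lam g) = diagram lam.
  rewrite E; apply/seteqP; split=> h; first by case=> [->|[]].
  by move=> dh; case: (pselect (h = g)) => [->|hg]; [left|right].
have ga : addable (remove_node lam g) g.
  by split; [rewrite E => -[_]; apply|exists lam].
by split=> //; apply: diagram_inj; rewrite add_nodeP.
Qed.

(** * Crystal operators move beads between two runners *)

Lemma eucl_uniq (e j i : nat) (q q' : int) : (j < e)%N -> (i < e)%N ->
  j%:Z + e%:Z * q' = i%:Z + e%:Z * q -> j = i /\ q' = q.
Proof.
move=> je ie E; have qq : q' = q by nia.
by split=> //; move: E; rewrite qq => /addIr [].
Qed.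

(** The index on its runner of a bead that sits in component [c], with quotient
    [q]; [rev_ord] is there because the level symbol lists its components in
    reverse order. *)
Definition kpos (l : nat) (c : 'I_l) (q : int) : int :=
  (rev_ord c)%:Z + l%:Z * q.

Lemma kpos_inj l (c c' : 'I_l) q q' : kpos c q = kpos c' q' -> c = c' /\ q = q'.
Proof.
move=> /(eucl_uniq (ltn_ord _) (ltn_ord _)) [cc ->]; split=> //.
exact/rev_ord_inj/val_inj.
Qed.

Lemma kpos_surj l k : (1 <= l)%N -> exists (c : 'I_l) q, k = kpos c q.
Proof.
move=> l1; have h1 := modz_ge0 k (d := l%:Z); have h2 := ltz_pmod k (d := l%:Z).
have hd : (absz (k %% l%:Z)%Z < l)%N by move: h1 h2; lia.
exists (rev_ord (Ordinal hd)), (k %/ l%:Z)%Z; rewrite /kpos rev_ordK /=.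
by have := divz_eq k l%:Z; move: h1; lia.
Qed.

Lemma max_iterE (T : Type) (f : T -> option T) x n :
  iterate f n x <> None -> iterate f n.+1 x = None -> max_iter f x = n.
Proof.
move=> fn fn1; apply: xget_unique.
  split=> // k fk; rewrite leqNgt; apply/negP => nk; apply: fk.
  rewrite /iterate -(subnK nk) iterD -/(iterate f n.+1 x) fn1.
  by elim: (k - n.+1)%N => //= t ->.
move=> k [fk kmax]; apply/eqP; rewrite eqn_leq kmax // andbT.
rewrite leqNgt; apply/negP => nk; apply: fk.
rewrite /iterate -(subnK nk) iterD -/(iterate f n.+1 x) fn1.
by elim: (k - n.+1)%N => //= t ->.
Qed.

Section Crystal.
Variables (e l i : nat) (s : charge l).
Hypotheses (e2 : (2 <= e)%N) (l1 : (1 <= l)%N).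
Hypotheses (i1 : (1 <= i)%N) (ie : (i < e)%N).
Implicit Types (lam mu : rpart l) (g h : node l).

Definition nodepos g : int := kpos g.2 ((content s g - i%:Z) %/ e%:Z)%Z.

Lemma residueP g : has_residue e i s g ->
  content s g = i%:Z + e%:Z * ((content s g - i%:Z) %/ e%:Z)%Z.
Proof.
rewrite /has_residue eqz_mod_dvd => /divzK; rewrite mulrC => ->; lia.
Qed.

(** This is where [e >= 2] is used: nodes with contents that differ by 1 have
    different residues. *)
Lemma residue_apart g h : has_residue e i s g -> has_residue e i s h ->
  content s h <> content s g + 1.
Proof.
move=> /residueP; move: (_ %/ _)%Z => q Eg /residueP; move: (_ %/ _)%Z => q' Eh.
rewrite Eg Eh => E; have {}E : e%:Z * (q' - q) = 1 by lia.
have : (q' - q <= 0) \/ (1 <= q' - q) by lia.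
by case=> d; nia.
Qed.

(** Adding [g] only affects the addability and removability of [g] and of its
    neighbours, and the latter have another residue. *)
Lemma addable_removable_add lam g h : has_residue e i s g ->
  has_residue e i s h ->
  addable lam g ->
  (addable (add_node lam g) h <-> addable lam h /\ h <> g) /\
  (removable (add_node lam g) h <-> removable lam h \/ h = g).
Proof.
move=> rg rh ga; have ng1 := residue_apart rg rh;
  have ng2 := residue_apart rh rg.
case: g h ga rg rh ng1 ng2 => -[a b] c -[[a' b'] c'] ga _ _ /= ng1 ng2.
have gr := (add_remove_node ga).1.
have pE k : (1 <= k)%N -> part (add_node lam (a, b, c) c') k =
   if (k == a) && (c' == c) then (part (lam c') k).+1 else part (lam c') k.
  by move=> k1; rewrite (add_node_part c' ga k1); case: ifP => _;
    rewrite ?addn0 ?addn1.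
have [a1 bE bh] := (addableP lam a b c).1 ga.
rewrite !addableP !removableP.
have [cc|cc] := eqVneq c' c; last first.
  have nE : (a', b', c') <> (a, b, c) by move=> [_ _ /eqP]; apply/negP.
  have {}pE k : (1 <= k)%N -> part (add_node lam (a, b, c) c') k =
    part (lam c') k.
    by move=> k1; rewrite pE // (negbTE cc) andbF.
  split; split.
  - move=> [h1 h2 h3]; rewrite (pE _ h1) in h2; split=> //; split=> // a'1.
    have a'2 : (0 < a'.-1)%N by lia.
    by rewrite -pE // h3.
  - move=> [[h1 h2 h3] _]; split=> // [|a'1]; first by rewrite pE.
    have a'2 : (0 < a'.-1)%N by lia.
    by rewrite pE // h3.
  - by move=> [h1 h2 h3 h4]; left; rewrite !pE // in h3 h4; split.
  - by case=> // -[h1 h2 h3 h4]; split; rewrite ?pE.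
subst c'; have {}pE k : (1 <= k)%N -> part (add_node lam (a, b, c) c) k =
    if k == a then (part (lam c) k).+1 else part (lam c) k.
  by move=> k1; rewrite pE // eqxx andbT.
have ne : (a', b', c) = (a, b, c) <-> a' = a /\ b' = b.
  by split=> [[-> ->]//|[-> ->]].
rewrite ne; split; split.
- move=> [h1]; rewrite pE //; case: eqP => [aa|naa] h2 h3; first by subst a';
  lia.
  split; last by case.
  split=> // a'1; have := h3 a'1; have a'2 : (0 < a'.-1)%N by lia.
  by rewrite pE //; case: eqP => // aE; rewrite aE; lia.
- move=> [[h1 h2 h3] nab]; split=> //.
    by rewrite pE //; case: eqP => // aa; case: nab; subst a'; split=> //; lia.
  move=> a'1; have := h3 a'1; have a'2 : (0 < a'.-1)%N by lia.
  by rewrite pE //; case: ifP => _; lia.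
- move=> [h1 h2]; rewrite pE //; case: eqP => [aa|naa] h3 h4.
    by right; split=> //; subst a'; lia.
  by left; split=> //; move: h4; rewrite pE //; case: ifP => _; lia.
- case=> [[h1 h2 h3 h4]|[aa bb]]; last by subst a' b'; apply/removableP.
  have naa : a' <> a by move=> aa; subst a'; lia.
  have /eqP/negbTE nE := naa.
  split=> //; rewrite pE // ?nE //; case: eqP => // aE; rewrite aE in h4 *.
  by have : b' <> b by [move=> bb; subst b'; lia]; lia.
Qed.

(** The signature as a list of nodes never changes along the crystal; only the
    letters do. *)
Lemma signature_add lam g : has_residue e i s g -> addable lam g ->
  signature e i s (add_node lam g) = signature e i s lam.
Proof.
move=> rg ga; have [ss sP] := signatureP e i s (add_node lam g).
apply: signature_unique => // h; rewrite sP; split=> -[rh H].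
  have [E1 E2] := addable_removable_add rg rh ga; move: H; rewrite E1 E2 => H;
    split=> //.
  by case: H => [[]|[|->]]; [left|right|left].
have [E1 E2] := addable_removable_add rg rh ga; rewrite E1 E2; split=> //.
case: (pselect (h = g)) => [->|hg]; first by right; right.
by case: H => [ah|rmh]; [left|right; left].
Qed.

Lemma in_signature lam g : g \in signature e i s lam ->
  has_residue e i s g /\ (addable lam g \/ removable lam g).
Proof. by have [_ sP] := signatureP e i s lam => /sP. Qed.

Lemma letterRE lam : {in signature e i s lam,
  forall g, letterR lam g = ~~ letterA lam g}.
Proof.
move=> g /in_signature[_ H]; apply/asboolP/negP.
  by move=> [dg _] /asboolP[].
by move=> nA; case: H => // aA; case: nA; apply/asboolP.
Qed.

Definition crystal_state lam := scan (letterA lam) (signature e i s lam).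

Lemma f_tildeE lam : f_tilde e i s lam =
  omap (add_node lam) (ohead (crystal_state lam).1).
Proof. by rewrite /crystal_state (scan_reduced (@letterRE lam)). Qed.

Lemma e_tildeE lam : e_tilde e i s lam =
  omap (remove_node lam) (ohead (rev (crystal_state lam).2)).
Proof. by rewrite /crystal_state (scan_reduced (@letterRE lam)) /= revK. Qed.

Lemma signature_uniq lam : uniq (signature e i s lam).
Proof.
apply: (sorted_uniq (@node_lt_trans _ s) (@node_lt_irr _ s)).
by have [] := signatureP e i s lam.
Qed.

Lemma crystal_flip lam g a b : has_residue e i s g -> addable lam g ->
  crystal_state lam = (g :: a, b) <->
  crystal_state (add_node lam g) = (a, rcons b g).
Proof.
move=> rg ga; rewrite /crystal_state signature_add //.
apply: scan_flip; first exact: signature_uniq.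
- exact/asboolP.
- apply/negP => /asboolP.
  by have [-> _] := addable_removable_add rg rg ga => -[_].
move=> h /in_signature[rh _] /eqP hg; apply/asboolP/asboolP.
  by have [-> _] := addable_removable_add rg rh ga.
by have [-> _] := addable_removable_add rg rh ga => -[].
Qed.

(** The runner [j] of the partition with level symbol given by [lam] and [s],
    read off that symbol. *)
Definition bead lam (j : nat) (k : int) : Prop :=
  exists (c : 'I_l) (q : int),
    k = kpos c q /\ symbol (s c) (lam c) (j%:Z + e%:Z * q).

Lemma bead_kpos lam j c q :
  bead lam j (kpos c q) <-> symbol (s c) (lam c) (j%:Z + e%:Z * q).
Proof. by split=> [[c' [q' [/kpos_inj[-> ->]]]]|h] //; exists c, q. Qed.

Lemma beta_inj (n : int) (p : intpart) j k : beta n p j = beta n p k -> j = k.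
Proof.
move=> E; case: (ltngtP j k) => // /(beta_lt n p); by rewrite E ltxx.
Qed.

Lemma add_node_symbol lam a b c c' y (x := content s (a, b, c)) :
  addable lam (a, b, c) ->
  symbol (s c') (add_node lam (a, b, c) c') y <->
  if c' == c then (symbol (s c') (lam c') y /\ y <> x - 1) \/ y = x
  else symbol (s c') (lam c') y.
Proof.
move=> ga; have [a1 bE _] := addable_bounds ga.
have pE k : (1 <= k)%N -> beta (s c') (add_node lam (a, b, c) c') k =
   if (k == a) && (c' == c) then beta (s c') (lam c') k + 1
   else beta (s c') (lam c') k.
  move=> k1; rewrite /beta (add_node_part c' ga k1).
  by case: ifP => _; rewrite ?addn0 ?addn1 //; lia.
have [cc|cc] := eqVneq c' c; last first.
  split=> -[k k1 ->]; exists k => //; rewrite pE // (negbTE cc) andbF //.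
subst c'; have xE : beta (s c) (lam c) a = x - 1.
  by rewrite /x /content bE /beta; lia.
split=> [[k k1 ->]|].
  rewrite pE // eqxx andbT; case: eqP => [->|ka]; first by right; rewrite xE;
    lia.
  by left; split; [exists k|rewrite -xE => /beta_inj].
case=> [[[k k1 ->] yx]|->]; last by exists a; rewrite ?pE // !eqxx xE /=; lia.
by exists k; rewrite ?pE //; case: eqP => //= ka; case: yx; rewrite ka xE.
Qed.

Lemma bead_add lam g j k : has_residue e i s g -> addable lam g -> (j < e)%N ->
  bead (add_node lam g) j k <->
  if j == i then bead lam j k \/ k = nodepos g
  else if j == i.-1 then bead lam j k /\ k <> nodepos g
  else bead lam j k.
Proof.
move=> rg ga je; have [c' [q' ->]] := kpos_surj k l1.
rewrite !(propext (bead_kpos _ _ _ _)); case: g ga rg => -[a b] c ga rg.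
rewrite add_node_symbol //; have xE := residueP rg.
rewrite /nodepos [snd _]/=; move: xE; set x := content _ _;
  set q := (_ %/ _)%Z => xE.
have E1 : j%:Z + e%:Z * q' = x <-> j = i /\ q' = q.
  by rewrite xE; split=> [/eucl_uniq|[-> ->]//]; apply.
have E2 : j%:Z + e%:Z * q' = x - 1 <-> j = i.-1 /\ q' = q.
  rewrite xE; have -> : i%:Z + e%:Z * q - 1 = i.-1%:Z + e%:Z * q by lia.
  by split=> [/eucl_uniq|[-> ->]//]; apply=> //; lia.
have K : kpos c' q' = kpos c q <-> c' = c /\ q' = q.
  by split=> [/kpos_inj|[-> ->]].
rewrite (propext E1) (propext E2) (propext K); have nii : i.-1 <> i by lia.
case: (eqVneq c' c) => cc; case: (eqVneq j i) => ji; try subst j.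
- subst c'; case: (pselect (q' = q)) => qq; intuition congruence.
- subst c'; have /eqP ji0 := ji.
  by case: eqP => ji'; case: (pselect (q' = q)) => qq; intuition congruence.
- by have /eqP ? := cc; intuition congruence.
by have /eqP ? := cc; have /eqP ? := ji; case: eqP => _; intuition congruence.
Qed.

Lemma addable_symbol lam a b c (x := content s (a, b, c)) :
  addable lam (a, b, c) ->
  symbol (s c) (lam c) (x - 1) /\ ~ symbol (s c) (lam c) x.
Proof.
move=> /addableP[a1 bE bh]; rewrite /x /= bE; split.
  by exists a => //; rewrite /beta; lia.
case=> k k1; rewrite /beta => E; case: (ltnP k a) => ka; last first.
  by have := part_le (lam c) ka; lia.
have a2 : (1 < a)%N by lia.
have ka' : (k <= a.-1)%N by lia.
by have := bh a2; have := part_le (lam c) ka'; lia.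
Qed.

Lemma bead_addable lam g : has_residue e i s g -> addable lam g ->
  bead lam i.-1 (nodepos g) /\ ~ bead lam i (nodepos g).
Proof.
case: g => -[a b] c rg /addable_symbol; rewrite /nodepos !bead_kpos.
have xE := residueP rg; move: xE; set x := content _ _;
  set q := (_ %/ _)%Z => xE.
by rewrite xE; have -> : i%:Z + e%:Z * q - 1 = i.-1%:Z + e%:Z * q by lia.
Qed.

Lemma bead_removable lam g : has_residue e i s g -> removable lam g ->
  bead lam i (nodepos g) /\ ~ bead lam i.-1 (nodepos g).
Proof.
move=> rg gr; have [ga <-] := remove_add_node gr.
have ii : (i.-1 == i) = false by lia.
rewrite !bead_add // ?eqxx ?ii; [|lia]; split; first by right.
by case.
Qed.

Lemma addable_bead lam k : bead lam i.-1 k -> ~ bead lam i k ->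
  exists g, [/\ has_residue e i s g, addable lam g & nodepos g = k].
Proof.
have [c [q ->]] := kpos_surj k l1; rewrite !bead_kpos => -[a a1 aE] nx.
have xE : content s (a, (part (lam c) a).+1, c) = i%:Z + e%:Z * q.
  by move: aE; rewrite /content /beta; lia.
exists (a, (part (lam c) a).+1, c); split.
- by rewrite /has_residue xE mulrC addrC modzMDl.
- apply/addableP; split=> // a2; rewrite ltnNge; apply/negP => h.
  apply: nx; exists a.-1; first by lia.
  by have := part_le (lam c) (leq_pred a); move: aE; rewrite /beta; lia.
by rewrite /nodepos xE /= addrC addKr mulKz //; lia.
Qed.

Lemma removable_bead lam k : bead lam i k -> ~ bead lam i.-1 k ->
  exists g, [/\ has_residue e i s g, removable lam g & nodepos g = k].
Proof.
have [c [q ->]] := kpos_surj k l1; rewrite !bead_kpos => -[a a1 aE] nx.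
have h : (part (lam c) a.+1 < part (lam c) a)%N.
  rewrite ltnNge; apply/negP => h; apply: nx; exists a.+1 => //.
  by have := part_le (lam c) (leqnSn a); move: aE; rewrite /beta; lia.
have xE : content s (a, part (lam c) a, c) = i%:Z + e%:Z * q.
  by move: aE; rewrite /content /beta; lia.
exists (a, part (lam c) a, c); split.
- by rewrite /has_residue xE mulrC addrC modzMDl.
- by apply/removableP; split=> //; lia.
by rewrite /nodepos xE /= addrC addKr mulKz //; lia.
Qed.

Lemma nodepos_mono lam : {in signature e i s lam &, forall g h,
  node_lt s g h -> nodepos g < nodepos h}.
Proof.
move=> g h /in_signature[rg _] /in_signature[rh _].
have := residueP rg; have := residueP rh; rewrite /node_lt /nodepos /kpos.
move: (_ %/ _)%Z => q' -> ; move: (_ %/ _)%Z => q -> /=.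
have := ltn_ord g.2; have := ltn_ord h.2; set cg := nat_of_ord g.2.
set ch := nat_of_ord h.2; clearbody cg ch => hc hg.
case/orP => [lt|/andP[/eqP E lt]].
  have qq : q + 1 <= q' by nia.
  have : l%:Z * (q + 1) <= l%:Z * q' by apply: ler_wpM2l.
  lia.
have qq : q = q' by nia.
rewrite qq; lia.
Qed.

Local Notation state := crystal_state.
Local Notation pos := nodepos.

Definition transfer (src dst : nat) lam mu (D : seq int) : Prop :=
  forall j k, (j < e)%N -> bead mu j k <->
    if j == dst then bead lam j k \/ k \in D
    else if j == src then bead lam j k /\ k \notin D
    else bead lam j k.

Lemma transfer0 src dst lam : transfer src dst lam lam [::].
Proof.
move=> j k _; case: ifP => _; first by split=> [|[]] //; left.
by case: ifP => _; split=> // -[].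
Qed.

Lemma state_signature lam g :
  (g \in (state lam).1) || (g \in (state lam).2) -> g \in signature e i s lam.
Proof. exact: scan_sub. Qed.

Lemma state_A lam g : g \in (state lam).1 ->
  has_residue e i s g /\ addable lam g.
Proof.
move=> ga.
have [rg _] : has_residue e i s g /\ (addable lam g \/ removable lam g).
  by apply: in_signature; apply: state_signature; rewrite ga.
split=> //; have [w1 [w2 [a' [a1 [_ gA _ _]]]]] := scan_unmatchedA ga.
exact/asboolP.
Qed.

Lemma state_R lam g : g \in (state lam).2 ->
  has_residue e i s g /\ removable lam g.
Proof.
move=> gb.
have [rg H] : has_residue e i s g /\ (addable lam g \/ removable lam g).
  by apply: in_signature; apply: state_signature; rewrite gb orbT.
split=> //; have [w1 [w2 [a' [a1 [_ /negP gA _ _ _]]]]] :=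
  scan_unmatchedR (signature_uniq lam) gb.
by case: H => // ga; case: gA; apply/asboolP.
Qed.

(** Successive operators f flip the unmatched letters A from the last one
    backwards. *)
Lemma iterate_f lam t : (t <= size (state lam).1)%N -> exists mu,
  [/\ iterate (f_tilde e i s) t lam = Some mu,
      state mu = (drop t (state lam).1, (state lam).2 ++ take t (state lam).1) &
      transfer i.-1 i lam mu (map pos (take t (state lam).1))].
Proof.
elim: t => [|t IH] ta.
  exists lam; split=> //; rewrite ?drop0 ?take0 ?cats0 -?surjective_pairing //.
  exact: transfer0.
have [mu [E1 E2 E3]] := IH (ltnW ta).
have g0 : node l by case: (state lam).1 ta.
pose g := nth g0 (state lam).1 t.
have dE : drop t (state lam).1 =
  g :: drop t.+1 (state lam).1 by rewrite -drop_nth.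
have tE : take t.+1 (state lam).1 = rcons (take t (state lam).1) g.
  by rewrite (take_nth g0).
have [rg ga] : has_residue e i s g /\ addable mu g.
  by apply: state_A; rewrite E2 dE mem_head.
exists (add_node mu g); split.
- by rewrite /iterate /= -/(iterate _ _ _) E1 /= f_tildeE E2 dE.
- rewrite tE -rcons_cat; apply/(crystal_flip _ _ rg ga).
  by rewrite E2 dE.
move=> j k je; rewrite tE map_rcons mem_rcons inE.
have nii : (i.-1 == i) = false by lia.
have := bead_add k rg ga je; have := E3 j k je.
case: (eqVneq j i) => ji; last case: (eqVneq j i.-1) => ji'; last first.
- by move=> -> ->.
- by move=> -> ->; rewrite negb_or (rwP eqP) -(rwP andP) -!(rwP negP); tauto.
by move=> -> ->; rewrite (rwP eqP) -(rwP orP); tauto.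
Qed.

(** Successive operators e flip the unmatched letters R from the first one on,
    that is, from the bottom of the stack. *)
Lemma iterate_e lam t (b := (state lam).2) : (t <= size b)%N -> exists mu,
  [/\ iterate (e_tilde e i s) t lam = Some mu,
      state mu = (drop (size b - t) b ++ (state lam).1, take (size b - t) b) &
      transfer i i.-1 lam mu (map pos (drop (size b - t) b))].
Proof.
elim: t => [|t IH] ta.
  exists lam; split=> //;
    rewrite subn0 ?drop_size ?take_size -?surjective_pairing //.
  exact: transfer0.
have [mu [E1 E2 E3]] := IH (ltnW ta).
have g0 : node l by case: (b) ta.
set n := (size b - t.+1)%N; have nE : (size b - t)%N = n.+1 by rewrite /n; lia.
have nb : (n < size b)%N by rewrite /n; lia.
rewrite nE in E2 E3.
pose g := nth g0 b n.
have tE : take n.+1 b = rcons (take n b) g by rewrite (take_nth g0).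
have dE : drop n b = g :: drop n.+1 b by rewrite -drop_nth.
have [rg gr] : has_residue e i s g /\ removable mu g.
  by apply: state_R; rewrite E2 tE mem_rcons mem_head.
have [ga gE] := remove_add_node gr.
exists (remove_node mu g); split.
- by rewrite /iterate /= -/(iterate _ _ _) E1 /= e_tildeE E2 tE rev_rcons.
- rewrite dE cat_cons; apply/(crystal_flip _ _ rg ga).
  by rewrite gE E2 tE.
move=> j k je; rewrite dE map_cons inE.
have n1 : (i == i.-1) = false by lia.
have n2 : (i.-1 == i) = false by lia.
have Ebg := bead_add k rg ga je; rewrite gE in Ebg.
(* [bead_add] describes [mu] from the partition without [g]; [B1] and [B2]
   invert this. *)
have [B1 B2] := bead_addable rg ga.
have := E3 j k je; move: Ebg; have [ki|/eqP ki] := eqVneq k (pos g).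
  subst k; case: (eqVneq j i) => ji; first by subst j; rewrite n1 /=;
    split=> [/B2|[]].
  by case: (eqVneq j i.-1) => ji'; [subst j; split=> // _; right|tauto].
case: (eqVneq j i) => ji; first by subst j; rewrite n1 /=; tauto.
by case: (eqVneq j i.-1) => ji'; rewrite /=; tauto.
Qed.

Lemma epsilonE lam : epsilon e i s lam = size (state lam).1.
Proof.
have [mu [E1 E2 _]] := iterate_f (leqnn (size (state lam).1)).
apply: max_iterE; first by rewrite E1.
by rewrite /iterate /= -/(iterate _ _ _) E1 /= f_tildeE E2 drop_size.
Qed.

Lemma phiE lam : phi e i s lam = size (state lam).2.
Proof.
have [mu [E1 E2 _]] := iterate_e (leqnn (size (state lam).2)).
apply: max_iterE; first by rewrite E1.
by rewrite /iterate /= -/(iterate _ _ _) E1 /= e_tildeE E2 subnn take0.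
Qed.

(** If [size a = size b], the star operation goes through its other branch,
    with no step to make. *)
Lemma star_up lam (a := (state lam).1) (b := (state lam).2) :
  (size b <= size a)%N ->
  transfer i.-1 i lam (star e i s lam) (map pos (take (size a - size b) a)).
Proof.
move=> ba; rewrite /star epsilonE phiE -/a -/b leq_eqVlt.
have [E|ne] := eqVneq (size a) (size b).
  by rewrite /= E subnn take0; apply: transfer0.
rewrite /= ltnNge ba /=.
have [mu [-> _ //]] := @iterate_f lam (size a - size b) (leq_subr _ _).
Qed.

Lemma star_down lam (a := (state lam).1) (b := (state lam).2) :
  (size a <= size b)%N ->
  transfer i i.-1 lam (star e i s lam) (map pos (drop (size a) b)).
Proof.
move=> ab; rewrite /star epsilonE phiE -/a -/b ab.
have [mu [-> _]] := @iterate_e lam (size b - size a) (leq_subr _ _).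
by rewrite subKn.
Qed.

Definition word lam : seq int := map pos (signature e i s lam).

Lemma word_sorted lam : sorted <%R (word lam).
Proof.
rewrite sorted_map; have [ss _] := signatureP e i s lam.
apply: (sub_in_sorted (P := mem (signature e i s lam)) (e := node_lt s)) => //.
  by move=> g h gs hs; apply: nodepos_mono gs hs.
Qed.

Lemma wordP lam k :
  k \in word lam <-> (bead lam i.-1 k /\ ~ bead lam i k) \/
                     (bead lam i k /\ ~ bead lam i.-1 k).
Proof.
have [_ sP] := signatureP e i s lam; split.
  case/mapP=> g /in_signature[rg H] ->; case: H => H.
    by left; apply: bead_addable.
  by right; apply: bead_removable.
move=> H; apply/mapP; case: H => -[h1 h2].
  by have [g [rg ga <-]] := addable_bead h1 h2; exists g => //; apply/sP; auto.
by have [g [rg ga <-]] := removable_bead h1 h2; exists g => //; apply/sP; auto.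
Qed.

Lemma word_scan lam (U : seq int) :
  {in word lam, forall k, k \in U <-> bead lam i.-1 k} ->
  scan (mem U) (word lam) = (map pos (state lam).1, map pos (state lam).2).
Proof.
move=> UE; rewrite /word scan_map.
suff -> : scan (preim pos (mem U)) (signature e i s lam) = state lam by [].
apply: eq_in_scan => g gs /=; have [rg H] := in_signature gs.
have pw : pos g \in word lam by apply: map_f.
apply/idP/asboolP => [/(UE _ pw) B|ga]; last first.
  by apply/(UE _ pw); have [] := bead_addable rg ga.
by case: H => // /(bead_removable rg)[].
Qed.

End Crystal.

(** * Exchanging two components of the symbol *)

Section Exchange.
Variables U V W : seq int.
Hypotheses (sU : sorted <%R U) (sV : sorted <%R V) (sW : sorted <%R W).
Hypothesis WE : forall k, (k \in W) = ((k \in U) != (k \in V)).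
Let a := (scan (mem U) W).1.
Let b := (scan (mem U) W).2.
Let uU : uniq U. Proof. exact: sorted_uniq lt_trans ltxx _ sU. Qed.
Let uV : uniq V. Proof. exact: sorted_uniq lt_trans ltxx _ sV. Qed.

Lemma unmatchedA_in x : x \in a -> x \in U /\ x \notin V.
Proof.
move=> xa; have xW : x \in W by apply: (@scan_sub _ (mem U)); rewrite xa.
have [w1 [w2 [a' [a1 [_ xU _ _]]]]] := scan_unmatchedA xa.
by have := WE x; rewrite xW; have -> : x \in U by []; case: (x \in V).
Qed.

Lemma unmatchedR_in x : x \in b -> x \in V /\ x \notin U.
Proof.
move=> xb; have xW : x \in W by apply: (@scan_sub _ (mem U)); rewrite xb orbT.
have uW : uniq W := sorted_uniq lt_trans ltxx sW.
have [w1 [w2 [b' [b1 [_ xU _ _ _]]]]] := scan_unmatchedR uW xb.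
have {}xU : x \notin U by [].
by have := WE x; rewrite xW (negbTE xU); case: (x \in V).
Qed.

Lemma exchange_size :
  [/\ uniq (exchange U V).1, uniq (exchange U V).2,
      size (exchange U V).1 = size V & size (exchange U V).2 = size U].
Proof.
rewrite /exchange; case: leqP => [sz|/ltnW sz] /=.
  have [Csub Cu Csz] := choose_up_sub sU sz; split=> //.
    rewrite cat_uniq filter_uniq // uV andbT /=; apply/hasPn => z zV.
    rewrite mem_filter; apply/negP => /andP[zC zU].
    move: zC; rewrite (choose_up_scan sU sV sW WE sz zU) =>
      /mem_take/unmatchedA_in.
    by rewrite zV => -[].
  by rewrite size_cat size_filter_notin // Csz subnK.
have [Csub Cu Csz] := choose_down_sub sV sz; split=> //.
  rewrite cat_uniq filter_uniq // uU andbT /=; apply/hasPn => z zU.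
  rewrite mem_filter; apply/negP => /andP[zC zV].
  move: zC; rewrite (choose_down_scan sU sV sW WE sz zV) =>
    /mem_drop/unmatchedR_in.
  by rewrite zU => -[].
by rewrite size_cat size_filter_notin // Csz subnK.
Qed.

Lemma exchange_sub x :
  x \in (exchange U V).1 ++ (exchange U V).2 -> x \in U ++ V.
Proof.
rewrite /exchange; case: leqP => [sz|/ltnW sz] /=; rewrite !mem_cat mem_filter.
  have [Csub _ _] := choose_up_sub sU sz.
  by case/or3P=> [/Csub ->|/andP[_ ->]|->]; rewrite ?orbT.
have [Csub _ _] := choose_down_sub sV sz.
by case/orP=> [/orP[/andP[_ ->]|->]|/Csub ->]; rewrite ?orbT.
Qed.

(** The entries left over by the greedy choice are the ones that change sides;
    [D] expresses them through the unmatched letters. *)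
Lemma exchange_up (D := take (size a - size b) a) : (size b <= size a)%N ->
  (forall x, x \in (exchange U V).1 = (x \in U) && (x \notin D)) /\
  (forall x, x \in (exchange U V).2 = (x \in V) || (x \in D)).
Proof.
have szE := size_symdiff sU sV sW WE; rewrite -/a -/b in szE.
move=> ba; have sz : (size V <= size U)%N by move: szE ba; clear; lia.
have DE : D = take (size U - size V) a.
  by rewrite /D; congr (take _ _); move: szE ba; clear; lia.
have [Csub Cu Csz] := choose_up_sub sU sz.
have H x : x \in U -> (x \notin choose_up U V) = (x \in D).
  by move=> xU; rewrite DE; apply: choose_up_scan.
have DU x : x \in D -> x \in U by move=> /mem_take/unmatchedA_in[].
rewrite /exchange sz; split=> x /=.
  case: (boolP (x \in U)) => xU; first by rewrite -H // negbK.
  by apply: contraNF xU => /Csub.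
rewrite mem_cat mem_filter orbC; congr orb.
by case: (boolP (x \in U)) => xU; rewrite ?andbT ?andbF ?H //; apply/esym;
  apply: contraNF xU => /DU.
Qed.

Lemma exchange_down (D := drop (size a) b) : (size a < size b)%N ->
  (forall x, x \in (exchange U V).1 = (x \in U) || (x \in D)) /\
  (forall x, x \in (exchange U V).2 = (x \in V) && (x \notin D)).
Proof.
have szE := size_symdiff sU sV sW WE; rewrite -/a -/b in szE.
move=> ab; have sz : (size U < size V)%N by move: szE ab; clear; lia.
have DE : D = drop (size U + size b - size V) b by rewrite szE addKn.
have sz' := ltnW sz.
have [Csub Cu Csz] := choose_down_sub sV sz'.
have H x : x \in V -> (x \notin choose_down V U) = (x \in D).
  by move=> xV; rewrite DE; apply: choose_down_scan.
have DV x : x \in D -> x \in V by move=> /mem_drop/unmatchedR_in[].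
rewrite /exchange leqNgt sz; split=> x /=; last first.
  case: (boolP (x \in V)) => xV; first by rewrite -H // negbK.
  by apply: contraNF xV => /Csub.
rewrite mem_cat mem_filter orbC; congr orb.
by case: (boolP (x \in V)) => xV; rewrite ?andbT ?andbF ?H //; apply/esym;
  apply: contraNF xV => /DV.
Qed.

End Exchange.

(** The charge of a symbol is determined by the number of its entries above any
    level [N] below which it is full. *)
Lemma charge_completed (n N : int) (mu : intpart) (T : seq int) :
  symbol n mu = completed N T -> uniq T -> {in T, forall x, N <= x} ->
  n = N + (size T)%:Z.
Proof.
move=> E uT TN.
have Nn : N <= n - (size mu)%:Z.
  rewrite leNgt; apply/negP => lt.
  have : symbol n mu (n - (size mu)%:Z) by rewrite E; left.
  case=> k k1; rewrite /beta; have := part_eq0 mu k1.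
  by case: ltnP => [h /eqP ->|h /negbT]; lia.
have [sE EP] := entries_fromP Nn.
have /perm_size : perm_eq (entries_from N n mu) T.
  apply: uniq_perm => // [|x]; first exact: sorted_uniq lt_trans ltxx _ sE.
  apply/idP/idP => [/EP[Nx]|xT].
    by rewrite E => -[] //; rewrite ltNge Nx.
  by apply/EP; rewrite TN // E; split=> //; right.
rewrite size_rev size_map size_iota => <-; lia.
Qed.

Section Completed.
Variables (N : int) (B : int -> Prop) (X D Y : seq int).
Hypothesis XE : forall k, k \in X <-> N <= k /\ B k.
Hypothesis low : forall k, k < N -> B k.
Hypothesis DN : forall k, k \in D -> N <= k.

Lemma completed_add k : (forall x, x \in Y = (x \in X) || (x \in D)) ->
  B k \/ k \in D <-> completed N Y k.
Proof.
move=> YE; rewrite /completed /= YE -(rwP orP) XE.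
have := low (k := k); have := DN (k := k); case: (ltP k N) => kN.
  by move=> _ bk; split=> _; left => //; apply: bk.
by split=> [[]|[|[[]|]]]; auto.
Qed.

Lemma completed_remove k : (forall x, x \in Y = (x \in X) && (x \notin D)) ->
  B k /\ k \notin D <-> completed N Y k.
Proof.
move=> YE; rewrite /completed /= YE -(rwP andP) XE.
have := low (k := k); have := DN (k := k); case: (ltP k N) => kN; last first.
  by move=> _ _; split=> [[]|[|[[]]]] //; right.
move=> h bk; split=> _; first by left.
by split; [exact: bk|apply/negP => /h].
Qed.

End Completed.

Lemma bead_tau_l (e l : nat) (m : int) (nu : intpart) (mu : rpart l)
    (s : charge l) (j : 'I_e) (k : int) : (1 <= e)%N -> (1 <= l)%N ->
  tau_l e l m nu = (mu, s) -> bead e s mu j k <-> residue_symbol m nu j k.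
Proof.
move=> e1 l1 E; have [c [q ->]] := kpos_surj k l1.
rewrite bead_kpos; have := tau_lE m nu c e1 l1; rewrite E /= => ->.
have posE : j%:Z + kpos c q * e%:Z =
    j%:Z + e%:Z * (rev_ord c)%:Z + e%:Z * l%:Z * q.
  by rewrite /kpos; lia.
rewrite /residue_symbol /= posE; split.
  by case=> c0 [q0 [c0e S /(eucl_uniq (ltn_ord j) c0e) [-> ->]]].
by move=> S; exists (nat_of_ord j), q; split.
Qed.

Theorem theorem5p6 (e l : nat) (m : int) (he : (2 <= e)%N) (hl : (1 <= l)%N)
    (lambda : intpart) (lambda_l : rpart l) (s_l : charge l)
    (lambda_e : rpart e) (s_e : charge e)
    (h_l : tau_l e l m lambda = (lambda_l, s_l))
    (h_e : tau_e e m lambda = (lambda_e, s_e))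
    (i : 'I_e) (hi : (1 <= i)%N) :
  tau_l_inv e m (star e i s_l lambda_l, s_l) =
  tau_e_inv m (Psi i s_e lambda_e, sigma_act i s_e).
Proof.
have e1 : (1 <= e)%N by apply: ltnW.
have ie := ltn_ord i.
have chl : charges m s_l.
  have [h _ _] := tau_l_bij m e1 hl; have := h lambda I; by rewrite h_l.
have che : charges m s_e.
  have [h _ _] := tau_e_bij m e1; have := h lambda I; by rewrite h_e.
(* Compare the runners of the partition [nu] on the left-hand side with the
   e-symbol that defines Psi. *)
set mu := star e i s_l lambda_l; set nu := tau_l_inv e m (mu, s_l).
have h_nu : tau_l e l m nu = (mu, s_l) by apply: tau_l_invK.
suff E : tau_e e m nu = (Psi i s_e lambda_e, sigma_act i s_e).
  rewrite -E; have [h inj _] := tau_e_bij m e1; apply: inj; rewrite ?in_setT //.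
  by rewrite tau_e_invK //; apply: h.
have lamE (j : 'I_e) k : symbol (s_e j) (lambda_e j) k <->
  bead e s_l lambda_l j k.
  by rewrite (bead_tau_l _ _ e1 hl h_l) -tau_eE // h_e.
have nuE (j : 'I_e) k : residue_symbol m nu j k <-> bead e s_l mu j k.
  by rewrite (bead_tau_l _ _ e1 hl h_nu).
pose p := prev_ord i.
have pi : (p == i) = false by apply/negbTE/eqP => /(congr1 val) /=; lia.
have pE : nat_of_ord p = i.-1 by [].
pose N := Num.min (s_e p - (size (lambda_e p))%:Z)
                  (s_e i - (size (lambda_e i))%:Z).
pose U := entries_from N (s_e p) (lambda_e p).
pose V := entries_from N (s_e i) (lambda_e i).
have Np : N <= s_e p - (size (lambda_e p))%:Z by rewrite /N ge_min lexx.
have Ni : N <= s_e i - (size (lambda_e i))%:Z by rewrite /N ge_min lexx orbT.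
have [sU UP] := entries_fromP Np; have [sV VP] := entries_fromP Ni.
rewrite -/U in sU UP; rewrite -/V in sV VP.
have {}UP k : k \in U <-> N <= k /\ bead e s_l lambda_l i.-1 k.
  by rewrite UP lamE.
have {}VP k : k \in V <-> N <= k /\ bead e s_l lambda_l i k.
  by rewrite VP lamE.
have low (n : int) (t : intpart) (k : int) : N <= n - (size t)%:Z -> k < N ->
  symbol n t k.
  move=> Nn kN; exists `|n - k|%N; first by lia.
  rewrite /beta; have /eqP -> : part t `|n - k| == 0%N by rewrite part_eq0; lia.
  lia.
have lowp k : k < N -> bead e s_l lambda_l i.-1 k by move=>
  /(low _ _ _ Np) /lamE.
have lowi k : k < N -> bead e s_l lambda_l i k by move=> /(low _ _ _ Ni) /lamE.
pose W := word e i s_l lambda_l.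
have sW : sorted <%R W by apply: word_sorted.
have WE k : (k \in W) = ((k \in U) != (k \in V)).
  have Wk := wordP s_l he hl hi ie lambda_l k.
  have Uk := UP k; have Vk := VP k.
  case: (ltP k N) => kN.
    have bp := lowp k kN; have bi := lowi k kN.
    have -> : (k \in U) = false by apply/negP => /UP[]; lia.
    have -> : (k \in V) = false by apply/negP => /VP[]; lia.
    by apply/negP => /Wk; tauto.
  case: (boolP (k \in U)) => [ku|/negP ku];
    case: (boolP (k \in V)) => [kv|/negP kv];
    by [apply/Wk; tauto | apply/negP => /Wk; tauto].
have WU : {in W, forall k, k \in U <-> bead e s_l lambda_l i.-1 k}.
  move=> k /(wordP s_l he hl hi ie lambda_l) Wk; rewrite UP; split=> [[]//|bp].
  split=> //; rewrite leNgt; apply/negP => kN.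
  by have bp' := lowp k kN; have bi := lowi k kN; tauto.
have scanE := word_scan he hl hi ie WU; rewrite -/W in scanE.
pose UV := exchange U V.
have [u1 u2 sz1 sz2] := exchange_size sU sV sW WE;
  rewrite -/UV in u1 u2 sz1 sz2.
have [R1 R2 R3] : [/\ forall k, bead e s_l mu i.-1 k <-> completed N UV.1 k,
  forall k, bead e s_l mu i k <-> completed N UV.2 k &
  forall (j : 'I_e) k, j != p -> j != i ->
    (bead e s_l mu j k <-> bead e s_l lambda_l j k)].
  have ip : (i == i.-1 :> nat) = false by lia.
  have pi' : (i.-1 == i) = false by lia.
  have i1e : (i.-1 < e)%N by lia.
  have jF (j : 'I_e) : j != p -> j != i ->
      (j == i :> nat) = false /\ (j == i.-1 :> nat) = false.
    by move=> jp ji; split; apply/negbTE.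
  set st := crystal_state e i s_l lambda_l in scanE.
  case: (leqP (size st.2) (size st.1)) => sz.
    have T := star_up he hl hi ie sz.
    have := exchange_up sU sV sW WE; rewrite scanE !size_map -map_take.
    set D := map _ _ in T *; rewrite -/UV => /(_ sz) [X1 X2].
    have DN k : k \in D -> N <= k.
      rewrite /D map_take => /mem_take kD; have := unmatchedA_in WE.
      by rewrite scanE => /(_ k kD)[/UP[]].
    split=> [k|k|j k jp ji].
    - have := T i.-1 k i1e; rewrite pi' eqxx => ->.
      exact: completed_remove UP lowp DN k X1.
    - have := T i k ie; rewrite eqxx => ->.
      exact: completed_add VP lowi DN k X2.
    by have [j1 j2] := jF j jp ji; have := T j k (ltn_ord j); rewrite j1 j2.
  have T := star_down he hl hi ie (ltnW sz).
  have := exchange_down sU sV sW WE; rewrite scanE !size_map -map_drop.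
  set D := map _ _ in T *; rewrite -/UV => /(_ sz) [X1 X2].
  have DN k : k \in D -> N <= k.
    rewrite /D map_drop => /mem_drop kD; have := unmatchedR_in sW WE.
    by rewrite scanE => /(_ k kD)[/VP[]].
  split=> [k|k|j k jp ji].
  - have := T i.-1 k i1e; rewrite eqxx => ->.
    exact: completed_add UP lowp DN k X1.
  - have := T i k ie; rewrite ip eqxx => ->.
    exact: completed_remove VP lowi DN k X2.
  by have [j1 j2] := jF j jp ji; have := T j k (ltn_ord j); rewrite j1 j2.
have RF (j : 'I_e) : residue_symbol m nu j =
    if j == p then completed N UV.1 else if j == i then completed N UV.2
    else symbol (s_e j) (lambda_e j).
  apply/funext => k; apply/propext; rewrite nuE.
  have [->|jp] := eqVneq j p; first exact: R1.
  have [->|ji] := eqVneq j i; first exact: R2.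
  by rewrite lamE; apply: R3.
have PsiE : (tau_e e m nu).1 = Psi i s_e lambda_e.
  by rewrite /tau_e /Psi; congr (fst (of_symbols _)); apply/funext => j;
    rewrite RF.
(* The charges are read off the numbers of entries from [N] on. *)
rewrite -PsiE [LHS]surjective_pairing; congr pair; apply/ffunP => j.
have nE := tau_eE m nu j e1; rewrite RF in nE; rewrite [RHS]ffunE; move: nE.
set n := (tau_e e m nu).2 j; set t := (tau_e e m nu).1 j => nE.
have UN : {in UV.1 ++ UV.2, forall k, N <= k}.
  by move=> k /(exchange_sub sU sV); rewrite mem_cat => /orP[/UP[]|/VP[]].
have szU : N + (size U)%:Z = s_e p.
  by rewrite size_rev size_map size_iota; move: Np; clear; lia.
have szV : N + (size V)%:Z = s_e i.
  by rewrite size_rev size_map size_iota; move: Ni; clear; lia.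
have [jp|jp] := eqVneq j p; last have [ji|ji] := eqVneq j i.
- move: nE; rewrite jp eqxx tpermL => nE; rewrite -szV -sz1.
  by apply: charge_completed nE u1 _ => k kU; apply: UN; rewrite mem_cat kU.
- move: nE; rewrite ji eqxx (eq_sym i) pi tpermR => nE; rewrite -szU -sz2.
  by apply: charge_completed nE u2 _ => k kU; apply: UN;
    rewrite mem_cat kU orbT.
move: nE; rewrite (negbTE jp) (negbTE ji) => /symbol_inj[_ ->].
by rewrite tpermD // eq_sym.
Qed.
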